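(* For every $\alpha\in[0,1]$ there exist a branch group $G_\alpha$ and a finitely generated subgroup $H\le G_\alpha$ such that $\dim_{G_\alpha}(H)=\alpha$. Further, $H$ is again a finitely generated branch group.
   Context: Trees. For a sequence $\bar l=(l_n)_{n\ge 0}$ of integers $l_n\ge 2$, $T_{\bar l}$ denotes the infinite spherically homogeneous rooted tree in which every vertex at distance $n$ from the root (level $n$) has exactly $l_n$ children; $\Omega(n)$ is the set of vertices of level $n$, so $|\Omega(n)|=\prod_{i=0}^{n-1}l_i$. $\operatorname{Aut}(T)$ is the group of root-preserving graph automorphisms of $T$. For a vertex $u$, $T_u$ is the subtree rooted at $u$ (consisting of $u$ and its descendants). Subgroups. For $G\le\operatorname{Aut}(T)$, the $n$-th level stabilizer is $\operatorname{St}_G(n)=\{g\in G: u^g=u \text{ for all } u\in\Omega(n)\}$. The rigid vertex stabilizer of $u$ is $\operatorname{rst}_G(u)=\{g\in G: v^g=v\text{ for all vertices } v\notin T_u\}$, and the $n$-th level rigid stabilizer is $\operatorname{rst}_G(n)=\prod_{u\in\Omega(n)}\operatorname{rst}_G(u)$ (an internal direct product in $G$). Branch groups. A subgroup $G\le\operatorname{Aut}(T_{\bar l})$ is a branch group if it acts transitively on every level $\Omega(n)$ and $\operatorname{rst}_G(n)$ has finite index in $G$ for every $n$. Saying that a subgroup $H\le G$ is again a branch group means that $H$ acts faithfully as a branch group on some infinite spherically homogeneous rooted tree (not necessarily the tree on which $G$ acts). Hausdorff dimension. The filtration $(\operatorname{St}_G(n))_{n\ge 0}$ of $G$ is used throughout.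 For $H\le G\le\operatorname{Aut}(T)$, $\dim_G(H)$ denotes the Hausdorff dimension of the closure of $H$ in the completion of $G$ with respect to the metric given by this filtration; equivalently $$\dim_G(H)=\liminf_{n\to\infty}\frac{\log|H/(H\cap \operatorname{St}_G(n))|}{\log|G/\operatorname{St}_G(n)|}.$$ *)

(* Defs.v *)
From HB Require Import structures.
From mathcomp Require Import all_boot all_order all_algebra finmap.
From mathcomp Require Import all_classical all_reals all_analysis.

Set Implicit Arguments.
Unset Strict Implicit.
Unset Printing Implicit Defensive.

Local Open Scope classical_set_scope.
Local Open Scope group_scope.

(* The i-th letter of a vertex, a number smaller than [l i], says which child *)
(* is taken when going down from level i to level i.+1.                       *)
Definition is_vertex (l : nat -> nat) (s : seq nat) : bool :=
  all (fun i => nth 0 s i < l i)%N (iota 0 (size s)).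

Definition vertex (l : nat -> nat) := {s : seq nat | is_vertex l s}.

Definition tree_root (l : nat -> nat) : vertex l := exist _ [::] isT.

Definition level (l : nat -> nat) (u : vertex l) : nat := size (val u).

Definition descendant (l : nat -> nat) (u v : vertex l) : bool :=
  prefix (val u) (val v).

Definition adjacent (l : nat -> nat) (u v : vertex l) : bool :=
  ((level v == (level u).+1) && descendant u v) ||
  ((level u == (level v).+1) && descendant v u).

Fixpoint level_words (l : nat -> nat) (n : nat) : seq (seq nat) :=
  if n is m.+1 then [seq rcons s x | s <- level_words l m, x <- iota 0 (l m)]
  else [:: [::]].

Definition Omega (l : nat -> nat) (n : nat) : seq (vertex l) :=
  pmap insub (level_words l n).

Lemma is_vertex_rcons (l : nat -> nat) (s : seq nat) (x : nat) :
  is_vertex l (rcons s x) = is_vertex l s && (x < l (size s))%N.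
Proof.
rewrite /is_vertex size_rcons -addn1 iotaD all_cat add0n /= andbT.
rewrite nth_rcons ltnn eqxx; congr (_ && _).
apply: eq_in_all => i; rewrite mem_iota /= add0n => ilt.
by rewrite nth_rcons ilt.
Qed.

Lemma mem_level_words (l : nat -> nat) (n : nat) (s : seq nat) :
  (s \in level_words l n) = is_vertex l s && (size s == n).
Proof.
elim: n s => [|n IHn] s; first by rewrite /= inE; case: s => // x s; rewrite andbF.
apply/allpairsP/idP => [[[t x] /= [tP xP ->]]|].
  move: tP xP; rewrite IHn mem_iota add0n is_vertex_rcons size_rcons eqSS.
  by case/andP=> -> /eqP -> /= ->; rewrite eqxx.
case/lastP: s => [|t x]; first by rewrite andbF.
rewrite is_vertex_rcons size_rcons eqSS => /andP[/andP[tP xP] /eqP tn].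
by exists (t, x); split=> //=; rewrite ?IHn ?tP ?tn ?eqxx // mem_iota -tn.
Qed.

Lemma level_words_uniq (l : nat -> nat) (n : nat) : uniq (level_words l n).
Proof.
elim: n => //= n IHn; apply: allpairs_uniq => //; first exact: iota_uniq.
by move=> [s x] [t y] _ _ /= /rcons_inj[-> ->].
Qed.

Lemma mem_Omega (l : nat -> nat) (n : nat) (u : vertex l) :
  (u \in Omega l n) = (level u == n).
Proof. by rewrite mem_pmap_sub mem_level_words (valP u). Qed.

Lemma Omega_uniq (l : nat -> nat) (n : nat) : uniq (Omega l n).
Proof. exact/pmap_sub_uniq/level_words_uniq. Qed.

Record Aut (l : nat -> nat) := MkAut {
  aut_fun :> vertex l -> vertex l ;
  aut_inv : vertex l -> vertex l ;
  aut_funK : cancel aut_fun aut_inv ;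
  aut_invK : cancel aut_inv aut_fun ;
  aut_root : aut_fun (tree_root l) = tree_root l ;
  aut_adj : forall u v, adjacent (aut_fun u) (aut_fun v) = adjacent u v }.

HB.instance Definition _ (l : nat -> nat) := gen_eqMixin (Aut l).
HB.instance Definition _ (l : nat -> nat) := gen_choiceMixin (Aut l).

Lemma autP (l : nat -> nat) (g h : Aut l) : g =1 h -> g = h.
Proof.
case: g h => [f f' fK f'K fr fa] [k k' kK k'K kr ka] /= /funext fk.
subst k; have f'k' : f' = k'.
  by apply/funext => v; rewrite -{1}(k'K v) fK.
by subst k'; congr MkAut; exact: Prop_irrelevance.
Qed.

Section AutGroup.
Variable l : nat -> nat.
Implicit Types g h : Aut l.

Definition aut1 : Aut l :=
  @MkAut l id id (fun=> erefl) (fun=> erefl) erefl (fun _ _ => erefl).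

(* Automorphisms act on the right: [g * h] is [g] followed by [h]. *)
Definition aut_mul g h : Aut l.
Proof.
exists (h \o g) (aut_inv g \o aut_inv h).
- exact: can_comp (aut_funK h) (aut_funK g).
- exact: can_comp (aut_invK g) (aut_invK h).
- by rewrite /= !aut_root.
- by move=> u v; rewrite /= !aut_adj.
Defined.

Definition autV g : Aut l.
Proof.
exists (aut_inv g) g.
- exact: aut_invK.
- exact: aut_funK.
- by rewrite -{1}(aut_root g) aut_funK.
- by move=> u v; rewrite -(aut_adj g) !aut_invK.
Defined.

Lemma aut_mulA : associative aut_mul. Proof. by move=> f g h; apply: autP. Qed.
Lemma aut_mul1g : left_id aut1 aut_mul. Proof. by move=> g; apply: autP. Qed.
Lemma aut_mulg1 : right_id aut1 aut_mul. Proof. by move=> g; apply: autP. Qed.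
Lemma aut_mulVg : left_inverse aut1 autV aut_mul.
Proof. by move=> g; apply: autP => v /=; rewrite aut_invK. Qed.
Lemma aut_mulgV : right_inverse aut1 autV aut_mul.
Proof. by move=> g; apply: autP => v /=; rewrite aut_funK. Qed.

HB.instance Definition _ := isGroup.Build (Aut l)
  aut_mulA aut_mul1g aut_mulg1 aut_mulVg aut_mulgV.

End AutGroup.

Section Groups.
Variable gT : groupType.
Implicit Types G H K : set gT.

Definition is_subgroup H : Prop :=
  [/\ H 1, forall g h, H g -> H h -> H (g * h) & forall g, H g -> H g^-1].

Definition finitely_generated H : Prop :=
  exists2 S : set gT, finite_set S & H = smallest is_subgroup S.

Definition cosets G K : set (set gT) :=
  [set [set g * k | k in K] | g in G].

(* Meaningful only when [K] has finite index in [G]; the junk value is 0. *)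
Definition subgroup_index G K : nat := #|` fset_set (cosets G K)|.

End Groups.

Section Stabilizers.
Variable l : nat -> nat.
Implicit Types G : set (Aut l).

Definition level_stab G (n : nat) : set (Aut l) :=
  [set g | G g /\ forall u, level u = n -> g u = u].

Definition rigid_stab G (u : vertex l) : set (Aut l) :=
  [set g | G g /\ forall v, ~~ descendant u v -> g v = v].

(* The factors commute with each other, so their order is irrelevant. *)
Definition rigid_level_stab G (n : nat) : set (Aut l) :=
  [set g | exists2 f : vertex l -> Aut l,
     forall u, level u = n -> rigid_stab G u (f u) &
     g = \prod_(u <- Omega l n) f u].

Definition branch G : Prop :=
  [/\ is_subgroup G,
      forall n (u v : vertex l), level u = n -> level v = n ->
        exists2 g, G g & g u = v &
      forall n, finite_set (cosets G (rigid_level_stab G n))].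

(* The Hausdorff dimension of (the closure of) [H] in the completion of [G]   *)
(* for the metric of the filtration [level_stab G], by the formula of Barnea  *)
(* and Shalev. The quotient at [n = 0] is the junk value [0 / 0].             *)
Definition hausdorff_dim (R : realType) G (H : set (Aut l)) : \bar R :=
  limn_einf (fun n =>
    (ln (subgroup_index H (H `&` level_stab G n))%:R /
     ln (subgroup_index G (level_stab G n))%:R)%R%:E : \bar R).

End Stabilizers.

Definition acts_as_branch_group (gT : groupType) (H : set gT) : Prop :=
  exists (l : nat -> nat) (phi : gT -> Aut l),
    [/\ forall n, (2 <= l n)%N,
        {in H &, {morph phi : g h / g * h}},
        {in H &, injective phi} &
        branch (phi @` H)].

(* Main.v *)
(* G is the full automorphism group of the tree in which the vertices of      *)
(* level n have k_n c_n children, and H is dense in the iterated wreath       *)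
(* product of the groups P_n = Alt(c_n) wr Alt(k_n) acting on the children.   *)
(* The orders of the level quotients are the products of the powers           *)
(* |Sym(k_i c_i)|^|Omega(i)| for G and |P_i|^|Omega(i)| for H. Since          *)
(* log |P_n| ~ k_n c_n log c_n and log (k_n c_n)! ~ k_n c_n log (k_n c_n),    *)
(* the dimension of H is lim log c_n / (log k_n + log c_n), which is alpha    *)
(* for k_n ~ c_n^((1 - alpha) / alpha), with an exponent that tends to        *)
(* infinity if alpha = 0.                                                     *)
(*   H is generated, as in the constructions of P. Neumann and Segal, by the  *)
(* rooted automorphisms in P_0 and by finitely many directed automorphisms,   *)
(* which act by generators of P_(n+1) at the child 1 of the vertex 0...0 of   *)
(* level n. If two directed automorphisms are conjugated apart by an element  *)
(* of P_0 that fixes 1 and moves 0, then their commutator acts only on the    *)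
(* children of the vertex 1, as a commutator of elements of P_1. As the P_n   *)
(* are perfect, H contains every copy of P_n at every vertex of level n, and  *)
(* hence all the restrictions of its elements to subtrees.                    *)

From mathcomp Require Import all_boot all_order all_algebra all_fingroup all_solvable.
From mathcomp Require Import zify.

Set Implicit Arguments.
Unset Strict Implicit.
Unset Printing Implicit Defensive.

(** * Generators of alternating groups and of their wreath products *)

(** An automorphism is the family of its labels, the permutations that it induces on the children of
    the vertices. If a subgroup has all its labels at level n in [P n] and contains every
    automorphism whose only nontrivial label is an element of [P n] at one vertex of level n, then
    its n-th level quotient realizes all such families of labels at the vertices of level less than
    n. Its order is therefore the product of the |P i|^|Omega(i)| for i < n ([index_level_stab]).
    The logarithms of the two indices are sums with the same weights |Omega(i)|, and the dimension
    is the limit of log |P n| / log |X n|!, by a Cesaro argument ([weighted_mean_cvg]).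

    This leaves a local and a global problem. Locally, [alt_wreath] provides perfect transitive
    groups with a number of generators independent of the degree, and the two block sizes tune the
    ratio of logarithms ([log_size_ratio]). Globally, [directed_group_spread] shows that finitely
    many rooted and directed automorphisms already generate every single label.

    Both groups are stable under [place], which cuts an element down to a subtree. Hence their rigid
    level stabilizers are the level stabilizers ([rigid_level_stabE]), which have finite index, and
    both groups are branch ([placed_branch]). *)

Section AlternatingGenerators.
Local Open Scope group_scope.
Variable m : nat.
Hypothesis m_even : ~~ odd m.
Notation n := m.+3.

Definition shift_perm : {perm 'I_n} := perm (@ordS_inj n).

Definition cycle3 : {perm 'I_n} :=
  tperm (inord 0) (inord 1) * tperm (inord 0) (inord 2).

Definition alt_gen (b : bool) : {perm 'I_n} := if b then cycle3 else shift_perm.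

Local Notation G := <<[set alt_gen b | b : bool]>>.

Lemma shift_permX (i : nat) (x : 'I_n) : (shift_perm ^+ i) x = inord ((x + i) %% n).
Proof.
elim: i x => [|i IHi] x; first by rewrite expg0 perm1 addn0 modn_small ?inord_val.
rewrite expgSr permM IHi permE; apply: val_inj => /=.
rewrite !inordK ?ltn_pmod // -addn1 modnDml.
by congr (_ %% _); lia.
Qed.

(** The degree n is odd, so the n-th power of the cycle has the sign of the cycle itself; that power
    is 1. *)
Lemma shift_perm_even : odd_perm shift_perm = false.
Proof.
have: shift_perm ^+ n = 1.
  apply/permP=> x; rewrite shift_permX perm1 modnDr modn_small //.
  by rewrite inord_val.
move=> /(congr1 (@odd_perm _)); rewrite odd_perm1.
have -> k : odd_perm (shift_perm ^+ k) = odd k && odd_perm shift_perm.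
  by elim: k => [|k IHk]; rewrite ?expg0 ?odd_perm1 // expgS odd_permM IHk /=; case: (odd_perm _); case: (odd k).
by rewrite /= m_even.
Qed.

Lemma cycle3_even : odd_perm cycle3 = false.
Proof.
rewrite odd_permM !odd_tperm -!val_eqE /= !inordK //.
Qed.

Lemma alt_gen_even b : odd_perm (alt_gen b) = false.
Proof. by case: b; rewrite /= ?cycle3_even ?shift_perm_even. Qed.

Lemma cycle3E (x : 'I_n) :
  cycle3 x = if x == 0%N :> nat then inord 1 else
             if x == 1%N :> nat then inord 2 else
             if x == 2%N :> nat then inord 0 else x.
Proof.
rewrite permM !permE /= -!val_eqE /= !inordK //.
by case: x => -[|[|[|x]]] Hx //=; rewrite ?inordK //=.
Qed.

(* Conjugating [cycle3] by powers of the long cycle gives the cycles           *)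
(* [i -> i + 1 -> i + 2 -> i].                                                 *)
Lemma move_up (j : nat) (y : 'I_n) : (1 < j < n)%N -> (y < j)%N ->
  exists2 g, g \in G & g y = inord y.+1 /\ forall z : 'I_n, (j < z)%N -> g z = z.
Proof.
move=> /andP[j1 jn] yj.
have inG b : alt_gen b \in G by rewrite mem_gen // imset_f.
pose tri i := cycle3 ^ (shift_perm ^+ i).
have triG i : tri i \in G.
  by rewrite groupJ ?(inG true) // groupX // (inG false).
have triE i (x : 'I_n) : (i + 2 < n)%N -> (i <= x)%N ->
   tri i x = inord (i + cycle3 (inord (x - i))).
  move=> i2 ix; rewrite /tri.
  have {1}-> : x = (shift_perm ^+ i) (inord (x - i)).
    have xi : (x - i < n)%N by have := ltn_ord x; lia.
    by apply: val_inj; rewrite shift_permX /= !inordK ?subnK ?modn_small.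
  rewrite permJ shift_permX; apply: val_inj.
  have xn := ltn_ord x.
  rewrite /= cycle3E inordK; last by lia.
  case: eqP => [e|_]; first by rewrite !inordK ?ltn_pmod // ?modn_small; lia.
  case: eqP => [e|_]; first by rewrite !inordK ?ltn_pmod // ?modn_small; lia.
  case: eqP => [e|_]; first by rewrite !inordK ?ltn_pmod // ?modn_small; lia.
  by rewrite !inordK ?ltn_pmod // ?modn_small; lia.
have fixes i (z : 'I_n) : (i + 2 <= j)%N -> (j < z)%N -> tri i z = z.
  move=> ij jz; have zn := ltn_ord z.
  rewrite triE; [|lia|lia].
  rewrite cycle3E inordK; last by lia.
  case: eqP => [e|_]; first by lia.
  case: eqP => [e|_]; first by lia.
  case: eqP => [e|_]; first by lia.
  by apply: val_inj; rewrite /= !inordK; lia.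
case: (leqP (y + 2) j) => [y2|y2].
  exists (tri y) => //; split; last by move=> z; exact: fixes.
  by rewrite triE; [rewrite cycle3E subnn !inordK //= addn1|lia|lia].
(* Here [y] is [j - 1]: the 3-cycle starts one point lower, so as to fix everything above [j]. *)
exists (tri (j - 2)) => //; split; last by move=> z; apply: fixes; lia.
rewrite triE; [|lia|lia].
have -> : (y - (j - 2) = 1)%N by lia.
by rewrite cycle3E !inordK //=; congr inord; lia.
Qed.

(** Induction on the number of initial points that may move: the image of the last of them is pushed
    back to its place by the 3-cycles of [move_up], and the product then moves fewer points. *)
Lemma Alt_gen : G = 'Alt_('I_n).
Proof.
apply/eqP; rewrite eqEsubset; apply/andP; split.
  rewrite gen_subG; apply/subsetP => _ /imsetP[b _ ->].
  by rewrite Alt_even alt_gen_even.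
apply/subsetP => s; rewrite Alt_even => s_even.
suff claim j : (1 < j <= n)%N -> forall s : {perm 'I_n}, ~~ s ->
    (forall z : 'I_n, (j <= z)%N -> s z = z) -> s \in G.
  by apply: (claim n); rewrite ?leqnn // => z; rewrite leqNgt ltn_ord.
elim: j => // j IHj jn {}s {}s_even s_fix.
(* Base case: only 0 and 1 may move, and parity excludes their transposition. *)
have [j1|j1] := leqP j 1.
  move: s_fix; have {j1 jn IHj}-> : j = 1%N by lia.
  move=> s_fix.
  have -> : s = 1; last exact: group1.
  have lt2 (z : 'I_n) : (z < 2)%N -> (s z < 2)%N.
    move=> z2; rewrite ltnNge; apply/negP => sz2.
    by have /perm_inj E := s_fix _ sz2; move: sz2; rewrite E; lia.
  have z0 (z : 'I_n) : z = 0%N :> nat -> z = inord 0 by move=> e; rewrite -e inord_val.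
  have z1 (z : 'I_n) : z = 1%N :> nat -> z = inord 1 by move=> e; rewrite -e inord_val.
  have i0 : @inord m.+2 0 = 0%N :> nat by rewrite inordK.
  have i1 : @inord m.+2 1 = 1%N :> nat by rewrite inordK.
  have [e0|e0] := eqVneq (s (inord 0)) (inord 0).
    have e1 : s (inord 1) = inord 1.
      apply: z1; have := lt2 (inord 1); rewrite i1 => /(_ isT).
      case E: (nat_of_ord (s (inord 1))) => [|[|u]] // _.
      by have := z0 _ E; rewrite -e0 => /perm_inj/(congr1 val) /=; rewrite i0 i1.
    apply/permP => z; rewrite perm1.
    have [/s_fix//|] := leqP 2 z.
    by case E: (nat_of_ord z) => [|[|u]] // _; [rewrite (z0 _ E)|rewrite (z1 _ E)].
  have e01 : s (inord 0) = inord 1.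
    apply: z1; have := lt2 (inord 0); rewrite i0 => /(_ isT).
    case E: (nat_of_ord (s (inord 0))) => [|[|u]] // _.
    by move: e0; rewrite (z0 _ E) eqxx.
  have e10 : s (inord 1) = inord 0.
    apply: z0; have := lt2 (inord 1); rewrite i1 => /(_ isT).
    case E: (nat_of_ord (s (inord 1))) => [|[|u]] // _.
    by have := z1 _ E; rewrite -{2}e01 => /perm_inj/(congr1 val) /=; rewrite i0 i1.
  suff E : s = tperm (inord 0) (inord 1).
    by move: s_even; rewrite E odd_tperm -val_eqE /= i0 i1.
  apply/permP => z; have [zz|] := leqP 2 z.
    by rewrite s_fix // tpermD // -val_eqE /= ?i0 ?i1; lia.
  by case E: (nat_of_ord z) => [|[|u]] // _; [rewrite (z0 _ E) tpermL|rewrite (z1 _ E) tpermR].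
have {j1} j1 : (1 < j < n)%N by lia.
have jn' : @inord m.+2 j = j :> nat by rewrite inordK; lia.
have lift d : forall s : {perm 'I_n}, ~~ s ->
    (forall z : 'I_n, (j < z)%N -> s z = z) -> (s (inord j) + d = j)%N -> s \in G.
  elim: d => [|d IHd] {s_even s_fix}s s_even s_fix sj.
    apply: IHj => //; first by case/andP: j1 => -> /ltnW.
    move=> z jz.
    have [e|ne] := eqVneq (nat_of_ord z) j; last first.
      by apply: s_fix; rewrite ltn_neqAle eq_sym ne.
    have -> : z = inord j by rewrite -e inord_val.
    by apply: val_inj; rewrite /= jn' -[RHS]sj addn0.
  have [|g gG [gy gfix]] := @move_up j (s (inord j)) j1; first by lia.
  have -> : s = (s * g) * g^-1 by rewrite mulgK.
  have g_even : ~~ g.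
    suff : g \in 'Alt_('I_n) by rewrite Alt_even.
    apply: subsetP gG; rewrite gen_subG; apply/subsetP => _ /imsetP[b _ ->].
    by rewrite Alt_even alt_gen_even.
  rewrite groupM ?groupV //; apply: IHd.
  - by rewrite odd_permM (negbTE s_even).
  - by move=> z jz; rewrite permM s_fix // gfix.
  - by rewrite permM gy inordK; have := ltn_ord (s (inord j)); lia.
apply: (lift (j - s (inord j))%N) => //.
have: (s (inord j) <= j)%N; last by lia.
rewrite leqNgt; apply/negP => sj.
by have /perm_inj E := s_fix _ sj; move: sj; rewrite E jn' ltnn.
Qed.

End AlternatingGenerators.

Section AlternatingGroup.
Local Open Scope group_scope.
Variable T : finType.

Lemma exists_notin (s : seq T) : (size s < #|T|)%N -> exists z, z \notin s.
Proof.
move=> sT; apply/existsP; rewrite -negb_forall; apply: contraL sT => /forallP sT.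
rewrite -leqNgt (leq_trans _ (card_size s)) // subset_leq_card //.
exact/subsetP.
Qed.

Lemma Alt_transitive (x y : T) : (2 < #|T|)%N -> exists2 s, s \in 'Alt_T & s x = y.
Proof.
move=> T3; have [->|xy] := eqVneq x y; first by exists 1; rewrite ?perm1 ?group1.
have [z] := @exists_notin [:: x; y] T3; rewrite !inE negb_or => /andP[zx zy].
exists (tperm x y * tperm x z); first by rewrite Alt_even odd_permM !odd_tperm xy eq_sym zx.
by rewrite permM tpermL tpermD // eq_sym.
Qed.

Lemma Alt_moves_fixing (x y : T) : (3 < #|T|)%N -> x != y ->
  exists2 s, s \in 'Alt_T & s y = y /\ s x != x.
Proof.
move=> T4 xy; have [z] := @exists_notin [:: x; y] (ltnW T4).
rewrite !inE negb_or => /andP[zx zy].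
have [w] := @exists_notin [:: x; y; z] T4.
rewrite !inE !negb_or => /and3P[wx wy wz].
exists (tperm x z * tperm x w).
  by rewrite Alt_even odd_permM !odd_tperm ![x == _]eq_sym zx wx.
by rewrite !permM tpermL !tpermD // ?(eq_sym x) // eq_sym.
Qed.

(** The derived subgroup is normal in a simple group, and it is not trivial because the group is not
    solvable. *)
Lemma Alt_perfect : (4 < #|T|)%N -> 'Alt_T \subset [~: 'Alt_T, 'Alt_T].
Proof.
move=> T5; have /simpleP[_ /(_ _ (der_normal 1 'Alt_T))] := simple_Alt5 T5.
case=> [/= A1|/= e]; last by rewrite derg1 in e; rewrite e.
have := solvable_AltF T5; rewrite abelian_sol // /abelian.
exact/commG1P.
Qed.
End AlternatingGroup.

(** * Imprimitive wreath products of two alternating groups *)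

Section WreathProduct.
Local Open Scope group_scope.
Variables K C : finType.

Definition top_fun (s : {perm K}) (z : K * C) := (s z.1, z.2).

Lemma top_fun_inj s : injective (top_fun s).
Proof. by move=> [x y] [x' y'] [/perm_inj-> ->]. Qed.

Definition top_perm s : {perm K * C} := perm (@top_fun_inj s).

Definition bot_fun (x : K) (t : {perm C}) (z : K * C) :=
  if z.1 == x then (z.1, t z.2) else z.

Lemma bot_fun_inj x t : injective (bot_fun x t).
Proof.
move=> [x1 y1] [x2 y2]; rewrite /bot_fun /=.
case: eqP => [->|x1x]; case: eqP => [->|x2x] //.
- by case=> /perm_inj->.
- by case=> e; case: x2x.
- by case=> e; case: x1x.
Qed.

Definition bot_perm x t : {perm K * C} := perm (@bot_fun_inj x t).

Lemma top_permE s z : top_perm s z = (s z.1, z.2). Proof. by rewrite permE. Qed.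

Lemma bot_permE x t z :
  bot_perm x t z = if z.1 == x then (z.1, t z.2) else z.
Proof. by rewrite permE. Qed.

Lemma top_permM : {in setT &, {morph top_perm : s t / s * t}}.
Proof. by move=> s t _ _; apply/permP => z; rewrite permM !top_permE permM. Qed.

Lemma bot_permM x : {in setT &, {morph bot_perm x : s t / s * t}}.
Proof.
move=> s t _ _; apply/permP => z; rewrite permM !bot_permE.
by case: ifP => /= [->|->//]; rewrite permM.
Qed.

Canonical top_perm_morphism := Morphism top_permM.
Canonical bot_perm_morphism x := Morphism (@bot_permM x).

Lemma bot_permJ x t s : bot_perm x t ^ top_perm s = bot_perm (s x) t.
Proof.
apply: (mulgI (top_perm s)); rewrite -conjgC; apply/permP => z.
rewrite !permM !(top_permE, bot_permE) /= (inj_eq perm_inj).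
by case: ifP => //= _; rewrite top_permE.
Qed.

(** One copy of the bottom group, in the block [x0], is enough: the top group permutes the blocks
    transitively and conjugates it to all others. *)
Definition alt_wreath (x0 : K) : {group {perm K * C}} :=
  ((top_perm @* 'Alt_K) <*> (bot_perm x0 @* 'Alt_C))%G.

Lemma top_alt_wreath x0 s : s \in 'Alt_K -> top_perm s \in alt_wreath x0.
Proof.
move=> sA; apply: (subsetP (joing_subl _ _)); exact: mem_morphim.
Qed.

Hypotheses (K4 : (4 < #|K|)%N) (C4 : (4 < #|C|)%N).
Variable x0 : K.
Local Notation W := (alt_wreath x0).

Lemma bot_alt_wreath x t : t \in 'Alt_C -> bot_perm x t \in W.
Proof.
move=> tA; have [s sA <-] := @Alt_transitive K x0 x (ltnW (ltnW K4)).
rewrite -bot_permJ groupJ ?top_alt_wreath //.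
by apply: (subsetP (joing_subr _ _)); exact: mem_morphim.
Qed.

Lemma alt_wreath_transitive z w : exists2 s, s \in W & s z = w.
Proof.
have [s sA sz] := @Alt_transitive K z.1 w.1 (ltnW (ltnW K4)).
have [t tA tz] := @Alt_transitive C z.2 w.2 (ltnW (ltnW C4)).
exists (bot_perm z.1 t * top_perm s).
  by rewrite groupM ?top_alt_wreath ?bot_alt_wreath.
by rewrite permM bot_permE eqxx top_permE /= sz tz -surjective_pairing.
Qed.

(** It suffices to act inside the block of [z]. If [z] and [w] have the same second coordinate, they
    lie in different blocks, so [w] is fixed anyway. *)
Lemma alt_wreath_moves_fixing z w : z != w ->
  exists2 s, s \in W & s w = w /\ s z != z.
Proof.
move=> zw.
have [t tA [tw tz]] : exists2 t, t \in 'Alt_C &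
    (z.1 = w.1 -> t w.2 = w.2) /\ t z.2 != z.2.
  have [e|ne] := eqVneq z.2 w.2.
    have [u] := @exists_notin C [:: z.2] (ltn_trans (isT : 1 < 4)%N C4).
    rewrite inE => uz.
    have [t tA tz] := @Alt_transitive C z.2 u (ltnW (ltnW C4)).
    exists t => //; split; last by rewrite tz.
    by move=> e1; case/eqP: zw; rewrite [z]surjective_pairing e1 e -surjective_pairing.
  by have [t tA [tw tz]] := Alt_moves_fixing (ltnW C4) ne; exists t.
exists (bot_perm z.1 t); first exact: bot_alt_wreath.
rewrite !bot_permE eqxx; split.
  by case: eqP => [e|//]; rewrite tw // -surjective_pairing.
by apply: contra tz => /eqP/(congr1 snd)/= ->.
Qed.

Lemma alt_wreath_perfect : W \subset [~: W, W].
Proof.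
rewrite /= join_subG; apply/andP; split.
  apply: subset_trans (morphimS _ (Alt_perfect K4)) _.
  by rewrite morphimR ?subsetT // commgSS ?joing_subl.
apply: subset_trans (morphimS _ (Alt_perfect C4)) _.
by rewrite morphimR ?subsetT // commgSS ?joing_subr.
Qed.

(** The index type of the generators does not involve [K] and [C]; this uniformity is what makes
    finitely many directed automorphisms suffice for all levels. *)
Lemma alt_wreath_gen (I : finType) (g : I -> {perm K}) (h : I -> {perm C}) :
  <<[set g i | i : I]>> = 'Alt_K -> <<[set h i | i : I]>> = 'Alt_C ->
  <<[set (if p.1 then top_perm (g p.2) else bot_perm x0 (h p.2)) | p : bool * I]>> = W.
Proof.
move=> gA hA; rewrite /= -gA -hA !morphim_gen ?subsetT //.
rewrite joing_idl joing_idr /joing; congr <<_>>; apply/setP => s.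
rewrite !morphimEsub ?subsetT // inE -!imset_comp; apply/imsetP/orP.
  case=> -[[] i] _ ->; [left|right]; exact: imset_f.
by case=> /imsetP[i _ ->]; [exists (true, i)|exists (false, i)].
Qed.

Lemma card_alt_wreath_ge : (#|'Alt_C| ^ #|K| <= #|W|)%N.
Proof.
pose F (f : {ffun K -> {perm C}}) := \prod_(x <- enum K) bot_perm x (f x).
have FE f z : F f z = (z.1, f z.1 z.2).
  have -> : F f z = if z.1 \in enum K then (z.1, f z.1 z.2) else z.
    rewrite /F; elim: (enum K) (enum_uniq K) z => [|x s IHs] /= us z.
      by rewrite big_nil perm1.
    have /andP[xs {}us] := us; rewrite big_cons permM bot_permE inE.
    case: eqP => [e|_] /=; last exact: IHs.
    by rewrite IHs //= e (negbTE xs).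
  by rewrite mem_enum.
rewrite -card_ffun_on -(card_in_imset (f := F)).
  apply/subset_leq_card/subsetP => _ /imsetP[f /ffun_onP fA ->].
  by apply: group_prod => x _; apply: bot_alt_wreath.
move=> f g _ _ /permP FF; apply/ffunP => x; apply/permP => y.
by have := FF (x, y); rewrite !FE => -[].
Qed.

(** An element preserves the partition into blocks, so it is determined by its map on blocks and by
    the second coordinates of its values. The count is crude but has the right logarithm to leading
    order. *)
Lemma card_alt_wreath_le (c : C) :
  (#|W| <= #|K| ^ #|K| * #|C| ^ (#|K| * #|C|))%N.
Proof.
have blocks s : s \in W -> forall x y y', (s (x, y)).1 = (s (x, y')).1.
  pose B := [set s : {perm K * C} |
    [forall x, forall y, forall y', (s (x, y)).1 == (s (x, y')).1]].
  have inB (t : {perm K * C}) : reflect (forall x y y', (t (x, y)).1 = (t (x, y')).1) (t \in B).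
    rewrite inE; apply: (iffP idP) => [H x y y'|H].
      by move: H => /forallP/(_ x)/forallP/(_ y)/forallP/(_ y')/eqP.
    by apply/forallP=> x; apply/forallP=> y; apply/forallP=> y'; apply/eqP.
  have Bgr : group_set B.
    apply/group_setP; split; first by apply/inB => x y y'; rewrite !perm1.
    move=> s1 s2 /inB H1 /inB H2; apply/inB => x y y'; rewrite !permM.
    rewrite [s1 (x, y)]surjective_pairing [s1 (x, y')]surjective_pairing.
    by rewrite (H1 x y y').
  move=> sW; apply/inB; apply: (subsetP _ _ sW).
  rewrite /= -[B]/(gval (group Bgr)).
  rewrite join_subG; apply/andP; split; apply/subsetP => _ /morphimP[t _ _ ->].
    by apply/inB => x y y'; rewrite /= !top_permE.
  by apply/inB => x y y'; rewrite /= !bot_permE /=; case: eqP.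
pose F (s : {perm K * C}) : {ffun K -> K} * {ffun K * C -> C} :=
  ([ffun x => (s (x, c)).1], [ffun z => (s z).2]).
have Finj : {in W &, injective F}.
  move=> s t sW tW [/ffunP e1 /ffunP e2]; apply/permP => -[x y].
  rewrite [LHS]surjective_pairing [RHS]surjective_pairing.
  have := e2 (x, y); rewrite !ffunE => ->.
  by rewrite (blocks s sW x y c) (blocks t tW x y c); have := e1 x; rewrite !ffunE => ->.
rewrite -(card_in_imset Finj) (leq_trans (max_card _)) //.
by rewrite card_prod !card_ffun card_prod.
Qed.

End WreathProduct.

(** * Automorphisms of a spherically homogeneous tree *)

From mathcomp Require Import finmap all_classical all_reals all_analysis ring lra.
Require Import Defs.

Section Portraits.
Local Open Scope group_scope.
Variable X : nat -> finType.
Local Notation l := (fun n => #|X n|).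

Definition letter n (x : X n) : nat := enum_rank x.

Lemma letter_lt n (x : X n) : (letter x < #|X n|)%N.
Proof. exact: ltn_ord. Qed.

Lemma letter_inj n : injective (@letter n).
Proof. by move=> x y /val_inj/enum_rank_inj. Qed.

Lemma letterP n y : (y < #|X n|)%N -> exists x : X n, y = letter x.
Proof.
by move=> yn; exists (enum_val (Ordinal yn)); rewrite /letter enum_valK.
Qed.

Definition ext n (s : {perm X n}) (y : nat) : nat :=
  if insub y is Some i then letter (s (enum_val (A := X n) i)) else y.

Lemma ext_letter n (s : {perm X n}) x : ext s (letter x) = letter (s x).
Proof. by rewrite /ext /letter valK enum_rankK. Qed.

Lemma ext_ge n (s : {perm X n}) y : (#|X n| <= y)%N -> ext s y = y.
Proof. by move=> yn; rewrite /ext insubF // ltnNge yn. Qed.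

Lemma ext_lt n (s : {perm X n}) y : (ext s y < #|X n|)%N = (y < #|X n|)%N.
Proof.
have [/letterP[x ->]|yn] := ltnP y #|X n|; first by rewrite ext_letter !letter_lt.
by rewrite ext_ge // ltnNge yn.
Qed.

Lemma ext1 n y : ext (1 : {perm X n}) y = y.
Proof.
have [/letterP[x ->]|/ext_ge//] := ltnP y #|X n|.
by rewrite ext_letter perm1.
Qed.

Lemma extM n (s t : {perm X n}) y : ext (s * t) y = ext t (ext s y).
Proof.
have [/letterP[x ->]|yn] := ltnP y #|X n|; first by rewrite !ext_letter permM.
by rewrite !ext_ge.
Qed.

Lemma extK n (s : {perm X n}) : cancel (ext s) (ext s^-1).
Proof. by move=> y; rewrite -extM mulgV ext1. Qed.

Lemma extVK n (s : {perm X n}) : cancel (ext s^-1) (ext s).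
Proof. by move=> y; rewrite -extM mulVg ext1. Qed.

Lemma ext_eq n (s t : {perm X n}) :
  (forall y, (y < #|X n|)%N -> ext s y = ext t y) -> s = t.
Proof.
move=> st; apply/permP => x; apply: letter_inj.
by rewrite -!ext_letter st ?letter_lt.
Qed.

(* The permutation [p n s] acts on the children of the vertex [s] of level [n];*)
(* the values at the other pairs [n, s] are irrelevant.                        *)
Definition portrait := forall n, seq nat -> {perm X n}.

Definition pact (p : portrait) (s : seq nat) : seq nat :=
  mkseq (fun i => ext (p i (take i s)) (nth 0%N s i)) (size s).

Lemma size_pact p s : size (pact p s) = size s.
Proof. exact: size_mkseq. Qed.

Lemma pact_rcons p s x :
  pact p (rcons s x) = rcons (pact p s) (ext (p (size s) s) x).
Proof.
rewrite /pact size_rcons mkseqS; congr rcons.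
  apply/eq_in_map => i; rewrite mem_iota /= => il.
  by rewrite nth_rcons il -cats1 takel_cat // ltnW.
by rewrite nth_rcons ltnn eqxx -cats1 takel_cat // take_size.
Qed.

Lemma vertex_pact p s : is_vertex l (pact p s) = is_vertex l s.
Proof.
elim/last_ind: s => // s x IHs.
by rewrite pact_rcons !is_vertex_rcons IHs size_pact ext_lt.
Qed.

Lemma pact_inj p : injective (pact p).
Proof.
move=> s; elim/last_ind: s => [|s x IHs] t.
  by move/(congr1 size); rewrite !size_pact; case: t.
case/lastP: t => [|t y]; first by move/(congr1 size); rewrite !size_pact size_rcons.
rewrite !pact_rcons => /rcons_inj[/IHs -> /(can_inj (@extK _ _)) ->//].
Qed.

Lemma take_pact p i s : take i (pact p s) = pact p (take i s).
Proof.
elim/last_ind: s => [|s x IHs]; first by case: i.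
rewrite pact_rcons -!cats1 !take_cat size_pact.
case: ltnP => // is_; case E: (i - size s) => [|k] /=.
  by rewrite !cats0.
by rewrite !cats1 pact_rcons.
Qed.

Fixpoint pact_inv_rec (p : portrait) n (t : seq nat) : seq nat :=
  if n is m.+1 then
    let s := pact_inv_rec p m t in rcons s (ext (p m s)^-1 (nth 0%N t m))
  else [::].

Definition pact_inv p t := pact_inv_rec p (size t) t.

Lemma pact_invK p : cancel (pact_inv p) (pact p).
Proof.
move=> t; rewrite /pact_inv.
suff H n : (n <= size t)%N -> pact p (pact_inv_rec p n t) = take n t.
  by rewrite H // take_size.
elim: n => [|n IHn] nt /=; first by rewrite take0.
have {}IHn := IHn (ltnW nt).
have sz : size (pact_inv_rec p n t) = n by rewrite -(size_pact p) IHn size_takel // ltnW.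
by rewrite pact_rcons IHn sz extVK (take_nth 0%N).
Qed.

Lemma pactK p : cancel (pact p) (pact_inv p).
Proof. by move=> s; apply: (@pact_inj p); rewrite pact_invK. Qed.

Lemma vertex_pact_inv p s : is_vertex l (pact_inv p s) = is_vertex l s.
Proof. by rewrite -(vertex_pact p) pact_invK. Qed.

Lemma prefix_pact p s t : prefix (pact p s) (pact p t) = prefix s t.
Proof.
by rewrite !prefixE size_pact take_pact (inj_eq (@pact_inj p)).
Qed.

Lemma vertex_pact_imp p s : is_vertex l s -> is_vertex l (pact p s).
Proof. by rewrite vertex_pact. Qed.

Lemma vertex_pact_inv_imp p s : is_vertex l s -> is_vertex l (pact_inv p s).
Proof. by rewrite vertex_pact_inv. Qed.

Definition lift_vertex (f : seq nat -> seq nat)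
    (fv : forall s, is_vertex l s -> is_vertex l (f s)) (u : vertex l) : vertex l :=
  exist _ (f (val u)) (fv _ (valP u)).

Definition paut (p : portrait) : Aut l.
Proof.
exists (lift_vertex (@vertex_pact_imp p)) (lift_vertex (@vertex_pact_inv_imp p)).
- by move=> u; apply: val_inj; rewrite /= pactK.
- by move=> u; apply: val_inj; rewrite /= pact_invK.
- exact: val_inj.
- by move=> u v; rewrite /adjacent /level /descendant /= !size_pact !prefix_pact.
Defined.

(** The action is made total on words, trivial outside the tree, so that words can be cut and
    extended without carrying proofs. *)
Definition wact (g : Aut l) (s : seq nat) : seq nat :=
  if insub s is Some u then val (g u) else s.

Lemma wact_val g (u : vertex l) : wact g (val u) = val (g u).
Proof. by rewrite /wact valK. Qed.

Lemma wact_vertex g s : is_vertex l s -> is_vertex l (wact g s).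
Proof. by move=> sv; rewrite -[s]/(val (exist _ s sv : vertex l)) wact_val; apply: valP. Qed.

Lemma wact_eq g h : (forall s, is_vertex l s -> wact g s = wact h s) -> g = h.
Proof.
by move=> gh; apply: autP => u; apply: val_inj; rewrite -!wact_val gh //; apply: valP.
Qed.

Lemma wact_paut p s : is_vertex l s -> wact (paut p) s = pact p s.
Proof. by move=> sv; rewrite -[s]/(val (exist _ s sv : vertex l)) wact_val. Qed.

Lemma wactM (g h : Aut l) s : wact (g * h) s = wact h (wact g s).
Proof.
have [sv|sv] := boolP (is_vertex l s); last by rewrite /wact !insubN // insubN.
by rewrite -[s]/(val (exist _ s sv : vertex l)) !wact_val.
Qed.

Lemma wact1 s : wact 1 s = s.
Proof.
have [sv|sv] := boolP (is_vertex l s); last by rewrite /wact insubN.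
by rewrite -[s]/(val (exist _ s sv : vertex l)) wact_val.
Qed.

Lemma wactK (g : Aut l) : cancel (wact g) (wact g^-1).
Proof. by move=> s; rewrite -wactM mulgV wact1. Qed.

Lemma wactVK (g : Aut l) : cancel (wact g^-1) (wact g).
Proof. by move=> s; rewrite -wactM mulVg wact1. Qed.

Lemma wact_inj g : injective (wact g).
Proof. exact: can_inj (wactK g). Qed.

Lemma wact_nil g : wact g [::] = [::].
Proof. by rewrite -[[::]]/(val (tree_root l)) wact_val aut_root. Qed.

Lemma wact_rcons g s x : is_vertex l (rcons s x) ->
  size (wact g s) = size s /\ exists y, wact g (rcons s x) = rcons (wact g s) y.
Proof.
elim/last_ind: s x => [|s z IHs] x sv; last first.
  have := sv; rewrite is_vertex_rcons => /andP[sv' _].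
  have [sz [y E]] := IHs z sv'; have szr : size (wact g (rcons s z)) = (size s).+1.
    by rewrite E size_rcons sz.
  split; first by rewrite szr size_rcons.
  pose u : vertex l := exist _ (rcons (rcons s z) x) sv.
  pose v : vertex l := exist _ (rcons s z) sv'.
  have := aut_adj g v u.
  have -> : adjacent v u.
    by rewrite /adjacent /level /descendant /= !size_rcons eqxx -[rcons _ x]cats1 prefix_prefix.
  rewrite /adjacent /level /descendant -!wact_val /= szr.
  case/orP=> /andP[/eqP szu]; rewrite prefixE => /eqP P.
    case/lastP: (wact g (rcons (rcons s z) x)) szu P => [|t w]; first by [].
    rewrite size_rcons => -[szt]; rewrite szr -szt -[rcons t w]cats1 takel_cat // take_size => ->.
    by exists w; rewrite cats1.
  (* The only other neighbour would be the parent, which is already the image of [s]; injectivity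
     excludes it. *)
  have : wact g (rcons (rcons s z) x) = wact g s.
    case: szu => szu; move: P.
    by rewrite -szu E -sz -[rcons (wact g s) y]cats1 takel_cat // take_size.
  by move/wact_inj/(congr1 size); rewrite !size_rcons; lia.
rewrite wact_nil; split=> //.
pose u : vertex l := exist _ [:: x] sv.
have := aut_adj g (tree_root l) u.
rewrite aut_root /adjacent /level /descendant -!wact_val /=.
by case: (wact g [:: x]) => [|y []] //= _; exists y.
Qed.

Lemma vertex_take i s : is_vertex l s -> is_vertex l (take i s).
Proof.
elim/last_ind: s => [|s x IHs]; first by case: i.
move=> sv; have := sv; rewrite is_vertex_rcons => /andP[/IHs sv' _].
have [si|si] := leqP i (size s); last by rewrite take_oversize // size_rcons.
by rewrite -cats1 takel_cat.
Qed.

Lemma size_wact g s : size (wact g s) = size s.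
Proof.
have [sv|sv] := boolP (is_vertex l s); last by rewrite /wact insubN.
elim/last_ind: s sv => [|s x IHs] sv; first by rewrite wact_nil.
have [sz [y ->]] := wact_rcons g sv.
by rewrite !size_rcons sz.
Qed.

Lemma take_wact g i s : is_vertex l s -> take i (wact g s) = wact g (take i s).
Proof.
elim/last_ind: s => [|s x IHs] sv; first by rewrite wact_nil; case: i => //=; rewrite wact_nil.
have [si|si] := leqP i (size s); last first.
  by rewrite !take_oversize ?size_wact ?size_rcons.
have [_ [y ->]] := wact_rcons g sv.
rewrite -!cats1 !takel_cat ?size_wact // IHs //.
by move: sv; rewrite is_vertex_rcons => /andP[].
Qed.

Lemma label_exists g s : is_vertex l s ->
  exists p : {perm X (size s)}, forall y, (y < #|X (size s)|)%N ->
    wact g (rcons s y) = rcons (wact g s) (ext p y).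
Proof.
move=> sv; pose n := size s.
have child (x : X n) : exists z : X n,
    wact g (rcons s (letter x)) = rcons (wact g s) (letter z).
  have xv : is_vertex l (rcons s (letter x)) by rewrite is_vertex_rcons sv letter_lt.
  have [_ [y E]] := wact_rcons g xv.
  have := wact_vertex g xv; rewrite E is_vertex_rcons size_wact => /andP[_ /letterP[z yz]].
  by exists z; rewrite -yz.
have [f fE] := choice child.
have f_inj : injective f.
  move=> x y fxy; have := fE y; rewrite -fxy -fE => /wact_inj/rcons_inj[].
  by move/letter_inj.
exists (perm f_inj) => y /letterP[x ->].
by rewrite ext_letter permE fE.
Qed.

(** By [label_exists], the default 1 is not taken when [s] is a vertex of level [n]. *)
Definition lab (g : Aut l) : portrait := fun n s =>
  xget 1 [set p : {perm X n} | forall y, (y < #|X n|)%N ->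
    wact g (rcons s y) = rcons (wact g s) (ext p y)]%classic.

Lemma labP g s y : is_vertex l s -> (y < #|X (size s)|)%N ->
  wact g (rcons s y) = rcons (wact g s) (ext (lab g (size s) s) y).
Proof.
move=> sv; rewrite /lab; case: xgetP => [p _ /(_ y)//|H].
by have [p /H] := label_exists g sv.
Qed.

Lemma lab_unique g s (p : {perm X (size s)}) : is_vertex l s ->
  (forall y, (y < #|X (size s)|)%N -> wact g (rcons s y) = rcons (wact g s) (ext p y)) ->
  lab g (size s) s = p.
Proof.
move=> sv H; apply: ext_eq => y yn.
by have := H y yn; rewrite labP // => /rcons_inj[].
Qed.

Lemma lab_paut p s : is_vertex l s -> lab (paut p) (size s) s = p (size s) s.
Proof.
move=> sv; apply: lab_unique => // y yn.
by rewrite !wact_paut ?is_vertex_rcons ?sv // pact_rcons.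
Qed.

Lemma labM (g h : Aut l) s : is_vertex l s ->
  lab (g * h) (size s) s = lab g (size s) s * lab h (size s) (wact g s).
Proof.
move=> sv; apply: lab_unique => // y yn.
rewrite !wactM labP // extM -(size_wact g s) labP ?wact_vertex //.
by rewrite size_wact ext_lt.
Qed.

Lemma lab1 s : is_vertex l s -> lab 1 (size s) s = 1.
Proof. by move=> sv; apply: lab_unique => // y yn; rewrite !wact1 ext1. Qed.

Lemma labV (g : Aut l) s : is_vertex l s ->
  lab g^-1 (size s) s = (lab g (size s) (wact g^-1 s))^-1.
Proof.
move=> sv; apply/(mulIg (lab g (size s) (wact g^-1 s))).
by rewrite -labM // mulVg lab1 // mulVg.
Qed.

Lemma eq_pact_upto (p q : portrait) n s : (size s <= n)%N -> is_vertex l s ->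
  (forall t, is_vertex l t -> (size t < n)%N -> p (size t) t = q (size t) t) ->
  pact p s = pact q s.
Proof.
move=> sn sv pq; elim/last_ind: s sn sv => // s x IHs.
rewrite size_rcons is_vertex_rcons => sn /andP[sv _].
by rewrite !pact_rcons IHs ?(ltnW sn) // pq.
Qed.

Lemma wact_lab g s : is_vertex l s -> wact g s = pact (lab g) s.
Proof.
elim/last_ind: s => [|s x IHs]; first by rewrite wact_nil.
rewrite is_vertex_rcons => /andP[sv xs].
by rewrite labP // pact_rcons IHs.
Qed.

Lemma eq_wact_upto g h n s : (size s <= n)%N -> is_vertex l s ->
  (forall t, is_vertex l t -> (size t < n)%N -> lab g (size t) t = lab h (size t) t) ->
  wact g s = wact h s.
Proof. by move=> sn sv gh; rewrite !wact_lab //; apply: eq_pact_upto gh. Qed.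

Lemma lab_eq g h :
  (forall s, is_vertex l s -> lab g (size s) s = lab h (size s) s) -> g = h.
Proof.
by move=> gh; apply: wact_eq => s sv; apply: (eq_wact_upto (leqnn _)) => // t tv _; apply: gh.
Qed.

Lemma eq_paut (p q : portrait) :
  (forall s, is_vertex l s -> p (size s) s = q (size s) s) -> paut p = paut q.
Proof. by move=> pq; apply: lab_eq => s sv; rewrite !lab_paut // pq. Qed.

Lemma pautM p q : paut p * paut q = paut (fun n s => p n s * q n (pact p s)).
Proof.
apply: lab_eq => s sv; rewrite labM // !lab_paut // wact_paut //.
by rewrite -(size_pact p s) lab_paut ?vertex_pact.
Qed.

Lemma paut1 : paut (fun n s => 1) = 1.
Proof. by apply: lab_eq => s sv; rewrite lab_paut // lab1. Qed.

Lemma pact_id (p : portrait) s : (forall i, (i < size s)%N -> p i (take i s) = 1) -> pact p s = s.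
Proof.
elim/last_ind: s => // s x IHs H; rewrite pact_rcons IHs.
  have := H (size s); rewrite size_rcons -cats1 takel_cat // take_size => -> //.
  by rewrite ext1 cats1.
by move=> i si; have := H i; rewrite size_rcons -cats1 takel_cat ?(ltnW si) //; apply; apply: ltnW.
Qed.

Definition antichain (Q : pred (seq nat)) :=
  forall s t, Q s -> Q t -> prefix s t -> s = t.

Definition supported (Q : pred (seq nat)) (p : portrait) :=
  forall n s, ~~ Q s -> p n s = 1.

Lemma pact_antichain Q p s : antichain Q -> supported Q p -> Q s -> pact p s = s.
Proof.
move=> Qa Qp Qs; apply: pact_id => i si; apply: Qp; apply/negP => Qt.
have /(congr1 size) := Qa _ _ Qt Qs (prefix_take s i).
by rewrite size_takel ?(ltnW si) // => e; rewrite e ltnn in si.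
Qed.

(** In general the label of the second factor is read at the image vertex. The path to a point of an
    antichain meets no other point of it, so both factors fix [Q] pointwise and labels simply
    multiply. *)
Lemma paut_antichainM Q (p q : portrait) : antichain Q -> supported Q p -> supported Q q ->
  paut p * paut q = paut (fun n s => p n s * q n s).
Proof.
move=> Qa Qp Qq; rewrite pautM; apply: eq_paut => s sv.
have [Qs|Qs] := boolP (Q s); first by rewrite (pact_antichain Qa Qp).
rewrite (Qq _ s Qs); have [Qs'|/Qq->//] := boolP (Q (pact p s)).
by have /pact_inj E := pact_antichain Qa Qp Qs'; rewrite E in Qs'; rewrite Qs' in Qs.
Qed.

Lemma paut_antichainV Q p : antichain Q -> supported Q p ->
  (paut p)^-1 = paut (fun n s => (p n s)^-1).
Proof.
move=> Qa Qp; apply/(mulgI (paut p)); rewrite mulgV (paut_antichainM Qa Qp).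
  by rewrite -paut1; apply: eq_paut => s _; rewrite mulgV.
by move=> n s /Qp->; rewrite invg1.
Qed.

(** The label depends only on the level, so moving the support by a conjugation does not alter the
    labels. *)
Definition spread (Q : pred (seq nat)) (a : forall n, {perm X n}) : Aut l :=
  paut (fun n s => if Q s then a n else 1).

End Portraits.

(** * Automorphisms supported on antichains, and directed automorphisms *)

Section Spreads.
Local Open Scope group_scope.
Variable X : nat -> finType.
Local Notation l := (fun n => #|X n|).
Local Notation dperm := (forall n, {perm X n}).
Implicit Types (a b : dperm) (Q : pred (seq nat)) (v s t : seq nat).

Lemma supported_spread Q a : supported Q (fun n s => if Q s then a n else 1).
Proof. by move=> n s /negbTE->. Qed.

Lemma supported_sub Q Q' (p : portrait X) :
  subpred Q Q' -> supported Q p -> supported Q' p.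
Proof. by move=> QQ' Qp n s Q's; apply: Qp; apply: contra Q's => /QQ'. Qed.

Lemma eq_spread Q Q' a : Q =1 Q' -> spread Q a = spread Q' a.
Proof. by move=> QQ'; apply: eq_paut => s _; rewrite QQ'. Qed.

Lemma spreadM Q a b : antichain Q ->
  spread Q a * spread Q b = spread Q (fun n => a n * b n).
Proof.
move=> Qa; rewrite (paut_antichainM Qa) //; try exact: supported_spread.
by apply: eq_paut => s _; case: ifP => // _; rewrite mulg1.
Qed.

Lemma spread1 Q : spread Q (fun=> 1) = 1 :> Aut l.
Proof. by rewrite -paut1; apply: eq_paut => s _; rewrite if_same. Qed.

Lemma spread_predU Q Q' a : antichain (predU Q Q') -> (forall s, Q s -> ~~ Q' s) ->
  spread (predU Q Q') a = spread Q a * spread Q' a.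
Proof.
move=> Qa QQ'; rewrite (paut_antichainM Qa); last 2 first.
- by apply: supported_sub (@supported_spread Q a) => s /= ->.
- by apply: supported_sub (@supported_spread Q' a) => s /= ->; rewrite orbT.
apply: eq_paut => s _ /=; have := QQ' s.
case: (Q s); case: (Q' s) => //= H; rewrite ?mulg1 ?mul1g //.
by have := H isT.
Qed.

Lemma antichain1 v : antichain (pred1 v).
Proof. by move=> s t /eqP-> /eqP->. Qed.

Lemma eq_spread1 v a b : a (size v) = b (size v) -> spread (pred1 v) a = spread (pred1 v) b.
Proof. by move=> ab; apply: eq_paut => s _ /=; case: eqP => // ->. Qed.

Lemma wact_spread Q a s : is_vertex l s ->
  wact (spread Q a) s = pact (fun n s => if Q s then a n else 1) s.
Proof. exact: wact_paut. Qed.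

Local Notation single v a := (fun n s => if pred1 v s then a n else 1).

Lemma pact_single v a y w :
  pact (single v a : portrait X) (v ++ y :: w) = v ++ ext (a (size v)) y :: w.
Proof.
elim/last_ind: w => [|w z IHw].
  rewrite cats1 pact_rcons (@pact_antichain X (pred1 v)) /= ?eqxx ?cats1 //.
  - exact: antichain1.
  - exact: supported_spread.
rewrite -!rcons_cons -!rcons_cat pact_rcons IHw ifF ?ext1 //.
by apply/eqP => /(congr1 size); rewrite size_cat /=; lia.
Qed.

Lemma spread_conj v a b Q Q' : antichain Q ->
  (forall s, Q s -> ~~ prefix s v) -> (forall s, Q' (pact (single v a) s) = Q s) ->
  (spread (pred1 v) a)^-1 * spread Q b * spread (pred1 v) a = spread Q' b.
Proof.
move=> Qa Qv QQ'; rewrite -mulgA; apply: (canLR (mulKg _)).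
rewrite !pautM; apply: eq_paut => s sv /=; rewrite QQ'.
have fixv : pact (fun n s => if Q s then b n else 1 : {perm X n}) v = v.
  apply: pact_id => i iv; rewrite ifF //; apply/negP => /Qv/negP; apply.
  exact: prefix_take.
have [->|sv'] := eqVneq s v.
  have -> : Q v = false by apply/negP => /Qv; rewrite prefix_refl.
  by rewrite fixv eqxx mul1g mulg1.
rewrite mul1g; case: eqP => [E|_]; last by rewrite mulg1.
by case/eqP: sv'; apply: (pact_inj (p := fun n s => if Q s then b n else 1)); rewrite E fixv.
Qed.

(* The vertices at which the directed automorphisms based at [v] act: they are *)
(* the children 1 of the vertices of the ray [v 0 0 0 ...].                    *)
Definition spine v : pred (seq nat) :=
  fun s => s == v ++ rcons (nseq (size s - size v).-1 0%N) 1%N.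

Lemma spineP v s : reflect (exists j, s = v ++ rcons (nseq j 0%N) 1%N) (spine v s).
Proof.
apply: (iffP eqP) => [{1}->|[j ->]]; first by eexists.
by rewrite !size_cat size_rcons size_nseq addKn.
Qed.

Lemma nseq01_prefix i j : prefix (rcons (nseq i 0%N) 1%N) (rcons (nseq j 0%N) 1%N) = (i == j).
Proof. by elim: i j => [|i IHi] [|j] //=; rewrite ?eqxx. Qed.

Lemma antichain_spine v : antichain (spine v).
Proof.
move=> _ _ /spineP[i ->] /spineP[j ->]; rewrite prefix_catr // eqxx andTb nseq01_prefix.
by move/eqP->.
Qed.

Lemma spine_not_prefix v s : spine v s -> ~~ prefix s v.
Proof.
move=> /spineP[j ->]; apply/negP => /size_prefix.
by rewrite size_cat size_rcons; lia.
Qed.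

Lemma spine_split v s : spine v s = spine (rcons v 0%N) s || (s == rcons v 1%N).
Proof.
apply/spineP/orP => [[[|j] ->]|].
- by right; rewrite cats1.
- by left; apply/spineP; exists j; rewrite cat_rcons.
- case=> [/spineP[j ->]|/eqP->]; first by exists j.+1; rewrite cat_rcons.
  by exists 0%N; rewrite cats1.
Qed.

Lemma spine_pact v (a : dperm) (x y : X (size v)) s :
  a (size v) x = y ->
  spine (rcons v (letter y)) (pact (single v a) s) = spine (rcons v (letter x)) s.
Proof.
move=> axy; apply/spineP/spineP => -[j E]; exists j; last first.
  by rewrite E !cat_rcons pact_single ext_letter axy.
by apply: (@pact_inj X (single v a)); rewrite E !cat_rcons pact_single ext_letter axy.
Qed.

Lemma rcons_pact v (a : dperm) (x y : X (size v)) s :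
  a (size v) x = y ->
  (pact (single v a) s == rcons v (letter y)) = (s == rcons v (letter x)).
Proof.
move=> axy; rewrite -[RHS](inj_eq (@pact_inj X (single v a))) -!cats1.
by rewrite pact_single ext_letter axy.
Qed.

Lemma rcons_not_prefix v y s : s = rcons v y -> ~~ prefix s v.
Proof. by move=> ->; apply/negP => /size_prefix; rewrite size_rcons ltnn. Qed.

Lemma spread_rcons_conj v (a b : dperm) (x y : X (size v)) : a (size v) x = y ->
  (spread (pred1 v) a)^-1 * spread (pred1 (rcons v (letter x))) b * spread (pred1 v) a =
  spread (pred1 (rcons v (letter y))) b.
Proof.
move=> axy; apply: spread_conj => [|s /eqP/rcons_not_prefix//|s].
  exact: antichain1.
exact: rcons_pact.
Qed.

Lemma spread_spine_conj v (a b : dperm) (x y : X (size v)) : a (size v) x = y ->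
  (spread (pred1 v) a)^-1 * spread (spine (rcons v (letter x))) b * spread (pred1 v) a =
  spread (spine (rcons v (letter y))) b.
Proof.
move=> axy; apply: spread_conj => [|s /spine_not_prefix|s].
- exact: antichain_spine.
- by apply: contra => sv; apply: prefix_trans sv (prefix_rcons _ _).
- exact: spine_pact.
Qed.

(* Conjugating by [c], which fixes the child 1 and moves the child 0 of [v],   *)
(* separates the supports of the two directed automorphisms except at [v 1].   *)
Lemma directed_commutator v (x0 x1 : X (size v)) (a b c : dperm) :
  letter x0 = 0%N -> letter x1 = 1%N ->
  c (size v) x1 = x1 -> c (size v) x0 != x0 ->
  let g := spread (spine v) a in
  let h := (spread (pred1 v) c)^-1 * spread (spine v) b * spread (pred1 v) c in
  g^-1 * h^-1 * g * h = spread (pred1 (rcons v 1%N)) (fun n => [~ a n, b n]).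
Proof.
move=> l0 l1 cx1; set z := c (size v) x0 => zx0 /=.
pose Qz := predU (spine (rcons v (letter z))) (pred1 (rcons v 1%N)).
have zl0 : letter z != 0%N by rewrite -l0 (inj_eq (@letter_inj _ _)).
have zl1 : letter z != 1%N.
  rewrite -l1 (inj_eq (@letter_inj _ _)); apply: contra_neq zx0.
  rewrite -cx1 => /perm_inj x01.
  by move: l1; rewrite -x01 l0.
rewrite (@spread_conj _ _ _ _ Qz); last 3 first.
- exact: antichain_spine.
- exact: spine_not_prefix.
- move=> s; rewrite spine_split -[in RHS]l1 -[in RHS]l0 /Qz /= (spine_pact s (erefl z)).
  by rewrite -[in LHS]l1 (rcons_pact s cx1).
(* The union of both supports is still an antichain, so the commutator is computed label by label
   and survives only at the common vertex [v 1]. *)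
pose Q s := [|| spine (rcons v 0%N) s, spine (rcons v (letter z)) s | s == rcons v 1%N].
have Qa : antichain Q.
  have head s : Q s -> exists y j, s = v ++ y :: j /\
      (y = 1%N /\ j = [::] \/ exists i, y <> 1%N /\ j = rcons (nseq i 0%N) 1%N).
    case/or3P => [/spineP[i ->]|/spineP[i ->]|/eqP->].
    - by exists 0%N, (rcons (nseq i 0%N) 1%N); rewrite cat_rcons; split=> //; right; exists i.
    - exists (letter z), (rcons (nseq i 0%N) 1%N); rewrite cat_rcons; split=> //.
      by right; exists i; split=> //; apply/eqP.
    - by exists 1%N, [::]; rewrite cats1; split=> //; left.
  move=> s t /head[y [j [-> H]]] /head[y' [j' [-> H']]].
  rewrite prefix_catr // eqxx andTb prefix_cons => /andP[/eqP e P]; subst y'.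
  case: H H' => [[-> ->]|[i [ny E]]] [[e1 E']|[i' [ny' E']]] //; subst j'=> //.
  by move: P; rewrite E nseq01_prefix => /eqP->.
have Q0 : subpred (spine v) Q.
  by move=> s; rewrite spine_split /Q => /orP[->|->]; rewrite ?orbT.
have Q1 : subpred Qz Q.
  by move=> s /orP[|] /= H; rewrite /Q H ?orbT.
have S0 := supported_sub Q0 (@supported_spread (spine v) a).
have S1 := supported_sub Q1 (@supported_spread Qz b).
have V (p : portrait X) : supported Q p -> supported Q (fun n s => (p n s)^-1).
  by move=> H n s /H->; rewrite invg1.
have M (p q : portrait X) : supported Q p -> supported Q q -> supported Q (fun n s => p n s * q n s).
  by move=> H H' n s Qs; rewrite H // H' // mulg1.
rewrite /spread (paut_antichainV Qa S0) (paut_antichainV Qa S1).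
rewrite (paut_antichainM Qa (V _ S0) (V _ S1)).
rewrite (paut_antichainM Qa (M _ _ (V _ S0) (V _ S1)) S0).
rewrite (paut_antichainM Qa (M _ _ (M _ _ (V _ S0) (V _ S1)) S0) S1).
apply: eq_paut => s _; rewrite /Qz /=.
have [->|s1] := eqVneq s (rcons v 1%N).
  have -> : spine v (rcons v 1%N) by rewrite spine_split eqxx orbT.
  by rewrite orbT commgEl conjgE !mulgA.
rewrite orbF; case: ifP => [S|_]; case: ifP => [S'|_]; rewrite ?invg1 ?mulg1 ?mul1g ?mulVg //.
move: S; rewrite spine_split (negbTE s1) orbF => /spineP[i E].
move: S'; rewrite E => /spineP[i']; rewrite !cat_rcons => /eqP.
by rewrite eqseq_cat // eqxx => /eqP[e _]; move: zl0; rewrite -e.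
Qed.

End Spreads.

(** * Transplanting the action on a subtree *)

Section Sections.
Local Open Scope group_scope.
Variable X : nat -> finType.
Local Notation l := (fun n => #|X n|).
Implicit Types (g h : Aut l) (u v w s t : seq nat) (x : vertex l).

Lemma is_vertex_swap u v w : size u = size v ->
  is_vertex l u -> is_vertex l (v ++ w) -> is_vertex l (u ++ w).
Proof.
move=> uv us; elim/last_ind: w => [|w y IHw]; first by rewrite !cats0.
rewrite -!rcons_cat !is_vertex_rcons => /andP[/IHw vw].
by rewrite vw !size_cat uv.
Qed.

(* Acts below [v] as [g] acts below [u], once the subtrees at [u] and at its   *)
(* image under [g] are both identified with the subtree at [v].                *)
Definition place u v g : Aut l :=
  paut (fun n s => if prefix v s then lab g n (u ++ drop (size v) s) else 1).

Lemma place_cat u v g w : size u = size v -> is_vertex l u -> is_vertex l (v ++ w) ->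
  pact (fun n s => if prefix v s then lab g n (u ++ drop (size v) s) else 1) (v ++ w) =
  v ++ drop (size u) (wact g (u ++ w)).
Proof.
move=> uv us; elim/last_ind: w => [|w y IHw] vs.
  rewrite !cats0 drop_oversize ?size_wact // cats0.
  apply: pact_id => i iv; rewrite ifF //; apply/negP => /size_prefix.
  by rewrite size_takel ?(ltnW iv) // leqNgt iv.
move: vs; rewrite -!rcons_cat is_vertex_rcons => /andP[vs xv].
have us' := is_vertex_swap uv us vs.
have e : size (v ++ w) = size (u ++ w) by rewrite !size_cat uv.
rewrite pact_rcons IHw // prefix_prefix drop_size_cat //.
rewrite e in xv *; rewrite labP // drop_rcons ?rcons_cat //.
by rewrite size_wact size_cat leq_addr.
Qed.

Lemma wact_place u v g w : size u = size v -> is_vertex l u -> is_vertex l (v ++ w) ->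
  wact (place u v g) (v ++ w) = v ++ drop (size u) (wact g (u ++ w)).
Proof. by move=> uv us vs; rewrite wact_paut // place_cat. Qed.

Lemma wact_place_id u v g s : is_vertex l s -> ~~ prefix v s -> wact (place u v g) s = s.
Proof.
move=> sv vs; rewrite wact_paut //; apply: pact_id => i si; rewrite ifF //.
by apply/negP => vi; move/negP: vs; apply; apply: prefix_trans vi (prefix_take _ _).
Qed.

(** The section of a product at [u] is that of [g] at [u] followed by that of [h] at the image of
    [u]; hence the source [u] and the target [v] of [place] must be allowed to differ. *)
Lemma place_mul u v g h : size u = size v -> is_vertex l u -> is_vertex l v ->
  place u v (g * h) = place u v g * place (wact g u) v h.
Proof.
move=> uv us vs; rewrite pautM; apply: eq_paut => s sv.
have [/prefixP[w sE]|vNs] := boolP (prefix v s).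
  rewrite {s}sE in sv *; have us' := is_vertex_swap uv us sv.
  rewrite place_cat // prefix_prefix !drop_size_cat //.
  have e : size (v ++ w) = size (u ++ w) by rewrite !size_cat uv.
  rewrite e labM //; congr (_ * lab h _ _).
  have -> : wact g u = take (size u) (wact g (u ++ w)) by rewrite take_wact // take_size_cat.
  by rewrite cat_take_drop.
rewrite ifF ?mulg1 //; apply/negP; rewrite prefixE take_pact => /eqP E.
have := place_cat g uv us (_ : is_vertex l (v ++ [::])).
rewrite cats0 drop_oversize ?size_wact ?size_cat ?addn0 // cats0 => /(_ vs) pv.
have e := pact_inj (etrans E (esym pv)).
by move/negP: vNs; apply; rewrite prefixE e.
Qed.

Lemma place1 u v : size u = size v -> is_vertex l u -> place u v 1 = 1.
Proof.
move=> uv us; rewrite -[RHS]paut1; apply: eq_paut => s sv.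
case: ifP => // /prefixP[w sE]; rewrite {s}sE in sv *; rewrite drop_size_cat //.
have e : size (v ++ w) = size (u ++ w) by rewrite !size_cat uv.
by rewrite e lab1 // (is_vertex_swap uv us sv).
Qed.

Lemma placeV u v g : size u = size v -> is_vertex l u -> is_vertex l v ->
  place u v g^-1 = (place (wact g^-1 u) v g)^-1.
Proof.
move=> uv us vs; apply/esym/(canLR invgK)/esym/eqP; rewrite eq_sym -mulg_eq1.
have us' := wact_vertex g^-1 us.
by rewrite -[X in place X v g^-1](wactVK g) -place_mul ?mulgV ?place1 ?size_wact.
Qed.

Lemma wact_prod_place h n (r : seq (vertex l)) s : uniq r ->
  all (fun x => size (val x) == n) r -> (forall x, size (val x) = n -> h x = x) ->
  is_vertex l s -> (n <= size s)%N ->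
  wact (\prod_(x <- r) place (val x) (val x) h) s =
  if take n s \in [seq val x | x <- r] then wact h s else s.
Proof.
move=> ru rn hn; have hfix t : is_vertex l t -> size t = n -> wact h t = t.
  by move=> tv tn; rewrite -[t]/(val (exist _ t tv : vertex l)) wact_val hn.
elim: r s ru rn => [|u r IHr] s /=; first by rewrite big_nil wact1.
move=> /andP[ur ru] /andP[/eqP un rn] sv sn; rewrite big_cons wactM inE.
have tn : size (take n s) = n by rewrite size_takel.
have [E|ne] := eqVneq (take n s) (val u).
  have sE : s = val u ++ drop n s by rewrite -E cat_take_drop.
  have uE : take n (wact h s) = val u by rewrite take_wact // hfix ?vertex_take.
  have -> : wact (place (val u) (val u) h) s = wact h s.
    rewrite [in LHS]sE wact_place ?(valP u) -?sE // un.
    by rewrite -[in LHS]uE cat_take_drop.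
  rewrite IHr ?size_wact ?wact_vertex //= uE mem_map ?(negbTE ur) //.
rewrite wact_place_id ?IHr //.
by apply: contra ne; rewrite prefixE un.
Qed.

Hypothesis X0 : forall n, (0 < #|X n|)%N.

Lemma vertex_extend n s : is_vertex l s -> (size s <= n)%N ->
  exists2 t, is_vertex l t & size t = n /\ take (size s) t = s.
Proof.
move=> sv sn; rewrite -(subnKC sn); elim: (n - size s)%N => [|k [t tv [tn ts]]].
  by exists s; rewrite ?addn0 ?take_size.
exists (rcons t 0%N); first by rewrite is_vertex_rcons tv X0.
by rewrite size_rcons tn addnS -cats1 takel_cat // tn leq_addr.
Qed.

Lemma level_fix_below h n s : (forall u : vertex l, level u = n -> h u = u) ->
  is_vertex l s -> (size s <= n)%N -> wact h s = s.
Proof.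
move=> hn sv sn; have [t tv [tn <-]] := vertex_extend sv sn.
rewrite -take_wact //; congr take.
by rewrite -[t]/(val (exist _ t tv : vertex l)) wact_val hn.
Qed.

Lemma level_stab_prod h n : (forall u : vertex l, level u = n -> h u = u) ->
  h = \prod_(x <- Omega l n) place (val x) (val x) h.
Proof.
move=> hn; have nOm : all (fun x => size (val x) == n) (Omega l n).
  by apply/allP => u; rewrite mem_Omega.
apply: wact_eq => s sv; have [ns|sn] := leqP n (size s).
  rewrite (wact_prod_place (n := n)) ?Omega_uniq // ifT //.
  apply/mapP; exists (exist _ (take n s) (vertex_take n sv)) => //.
  by rewrite mem_Omega /level /= size_takel.
have [t tv [tn <-]] := vertex_extend sv (ltnW sn).
rewrite -!take_wact // (wact_prod_place (n := n)) ?Omega_uniq ?tn //.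
by rewrite (level_fix_below hn tv) ?tn // if_same.
Qed.

End Sections.

(** * Counting cosets and generating subgroups *)

Section Subgroups.
Local Open Scope group_scope.
Local Open Scope classical_set_scope.
Variable gT : groupType.
Implicit Types G K : set gT.

(** The values of [f] are a complete invariant of the cosets, so choosing a preimage [r y] of each
    [y] in [A] gives a transversal. *)
Lemma cosets_image G K (T : finType) (f : gT -> T) (A : {set T}) : is_subgroup K ->
  (forall g h, G g -> G h -> f g = f h <-> K (g^-1 * h)) ->
  (forall g, G g -> f g \in A) -> (forall y, y \in A -> exists2 g, G g & f g = y) ->
  finite_set (cosets G K) /\ subgroup_index G K = #|A|.
Proof.
move=> [K1 KM KV] fK fA Af.
have [y|r rP] := @choice T gT (fun y g => y \in A -> G g /\ f g = y).
  have [/Af[g Gg fg]|yA] := boolP (y \in A).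
    by exists g.
  by exists 1.
pose c y : set gT := [set r y * k | k in K].
have coset_eq g h : G g -> G h -> f g = f h ->
    [set g * k | k in K] `<=` [set h * k | k in K].
  move=> Gg Gh /esym /(fK _ _ Gh Gg) Kgh _ [k Kk <-].
  by exists (h^-1 * g * k); [exact: KM|rewrite !mulgA mulgV mul1g].
have E : cosets G K = [set` [fset c y | y in A]%fset].
  apply/seteqP; split=> [_ [g Gg <-]|_ /imfsetP[y /= yA ->]].
    apply/imfsetP; exists (f g) => /=; first exact: fA.
    have [Gr fr] := rP _ (fA _ Gg).
    by apply/seteqP; split; apply: coset_eq.
  by have [Gr _] := rP _ yA; exists (r y).
split; first by rewrite E; apply: finite_fset.
rewrite /subgroup_index E set_fsetK card_in_imfset /=.
  by rewrite -cardE.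
move=> y z /= yA zA cyz; have [Gy fy] := rP _ yA; have [Gz fz] := rP _ zA.
rewrite -fy -fz; apply/fK => //.
have : c z (r z) by exists 1; rewrite ?mulg1.
by rewrite -cyz => -[k Kk <-]; rewrite mulKg.
Qed.

Lemma smallest_subgroup (S : set gT) : is_subgroup (smallest (@is_subgroup gT) S).
Proof.
split=> [K [[] //]|g h Hg Hh K KS|g Hg K KS]; case: (KS) => -[K1 KM KV] _.
  by apply: KM; [apply: Hg|apply: Hh].
by apply: KV; apply: Hg.
Qed.

End Subgroups.

(** * Level quotients and a criterion for being branch *)

Section Levels.
Local Open Scope group_scope.
Variable X : nat -> finType.
Hypothesis X0 : forall n, (0 < #|X n|)%N.
Local Notation l := (fun n => #|X n|).
Local Notation dperm := (forall n, {perm X n}).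
Implicit Types (g h : Aut l) (s t v : seq nat) (a : dperm) (u : vertex l).

Lemma size_level_words n : size (level_words l n) = (\prod_(i < n) #|X i|)%N.
Proof.
elim: n => [|n IHn]; first by rewrite big_ord0.
by rewrite big_ord_recr /= size_allpairs size_iota IHn.
Qed.

Fixpoint truncation (n : nat) : finType :=
  if n is m.+1 then (truncation m * {ffun seq_sub (level_words l m) -> {perm X m}})%type
  else unit.

Fixpoint truncate g n : truncation n :=
  if n is m.+1 then (truncate g m, [ffun t => lab g m (val t)]) else tt.

Fixpoint local_truncations (P : forall n, {group {perm X n}}) n : {set truncation n} :=
  if n is m.+1 then finset.setX (local_truncations P m)
    (finset (mem (ffun_on (mem (P m))) : pred {ffun seq_sub (level_words l m) -> {perm X m}}))
  else [set: unit]%SET.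

Lemma card_local_truncations (P : forall n, {group {perm X n}}) n :
  #|local_truncations P n| = (\prod_(i < n) #|P i| ^ (\prod_(j < i) #|X j|))%N.
Proof.
elim: n => [|n IHn]; first by rewrite big_ord0 /= finset.cardsT card_unit.
rewrite big_ord_recr /= cardsX IHn cardsE card_ffun_on card_seq_sub ?level_words_uniq //.
by rewrite size_level_words.
Qed.

Lemma truncate_eq g h n : truncate g n = truncate h n <->
  forall s, is_vertex l s -> (size s < n)%N -> lab g (size s) s = lab h (size s) s.
Proof.
elim: n => [|n IHn] /=; first by split.
split=> [[/IHn gh /ffunP ghn] s sv|gh].
  rewrite ltnS leq_eqVlt => /orP[/eqP sn|]; last exact: gh.
  have sin : s \in level_words l (size s) by rewrite mem_level_words sv eqxx.
  by subst n; have := ghn (SeqSub sin); rewrite !ffunE.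
congr pair; first by apply/IHn => s sv sn; apply: gh => //; apply: ltnW.
apply/ffunP => -[s sP]; rewrite !ffunE /=; have := sP; rewrite mem_level_words => /andP[sv /eqP sn].
by move: sP; subst n => _; apply: gh.
Qed.

Lemma agree_labels g h n :
  (forall s, is_vertex l s -> (size s < n)%N -> lab g (size s) s = lab h (size s) s) <->
  (forall u, level u = n -> (g^-1 * h) u = u).
Proof.
split=> [gh u un|gh s sv sn].
  apply: val_inj; rewrite -wact_val wactM.
  have uv := wact_vertex g^-1 (valP u).
  by rewrite -(eq_wact_upto (g := g) _ uv gh) ?wactVK // size_wact -un.
have E t : is_vertex l t -> (size t <= n)%N -> wact g t = wact h t.
  move=> tv tn; rewrite -[h](mulKVg g) wactM.
  by rewrite (level_fix_below X0 gh) ?wact_vertex ?size_wact.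
apply: lab_unique => // y yn; have yv : is_vertex l (rcons s y) by rewrite is_vertex_rcons sv.
by rewrite E ?size_rcons // labP // E // ltnW.
Qed.

Lemma truncate_eq_level g h n : truncate g n = truncate h n <->
  (forall u, level u = n -> (g^-1 * h) u = u).
Proof. exact: iff_trans (truncate_eq g h n) (agree_labels g h n). Qed.

Lemma truncate_local (P : forall n, {group {perm X n}}) g n :
  (forall s, is_vertex l s -> lab g (size s) s \in P (size s)) ->
  truncate g n \in local_truncations P n.
Proof.
move=> gP; elim: n => [|n IHn] /=; first by rewrite finset.inE.
rewrite finset.inE /= IHn finset.inE; apply/ffun_onP => -[s sP]; rewrite ffunE /=.
by move: (sP); rewrite mem_level_words => /andP[sv /eqP <-]; apply: gP.
Qed.

Section Singles.
Variables (G : set (Aut l)) (P : forall n, {group {perm X n}}).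
Hypothesis G_subgroup : is_subgroup G.
Hypothesis G_single : forall v a, is_vertex l v -> a (size v) \in P (size v) ->
  G (spread (pred1 v) a).

Hypothesis G_lab : forall g s, G g -> is_vertex l s -> lab g (size s) s \in P (size s).

Lemma paut_level_mem m (r : seq (seq nat)) (p : portrait X) : uniq r ->
  (forall s, s \in r -> [/\ is_vertex l s, size s = m & p (size s) s \in P (size s)]) ->
  G (paut (fun n s => if s \in r then p n s else 1)).
Proof.
case: G_subgroup => G1 GM _.
elim: r => [|t r IHr] /= ur rP; first by rewrite paut1.
have /andP[tr {}ur] := ur.
have [tv tm tP] := rP t (mem_head _ _).
have -> : paut (fun n s => if s \in t :: r then p n s else 1) =
    spread (pred1 t) (fun n => p n t) * paut (fun n s => if s \in r then p n s else 1).
  rewrite (@paut_antichainM _ [pred s | s \in t :: r]).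
  - apply: eq_paut => s _ /=; rewrite inE; have [->|] := eqVneq s t.
      by rewrite (negbTE tr) mulg1.
    by rewrite mul1g.
  - move=> s s' /= /rP[_ sm _] /rP[_ sm' _]; rewrite prefixE sm -sm' take_size.
    by move/eqP.
  - by move=> n s /=; rewrite inE negb_or => /andP[/negbTE->].
  - by move=> n s /=; rewrite inE negb_or => /andP[_ /negbTE->].
apply: GM; first exact: G_single.
by apply: IHr => // s sr; apply: rP; rewrite inE sr orbT.
Qed.

(** Labels are adjusted one level at a time, by multiplying with single labels at the vertices of
    that level. *)
Lemma truncate_onto n y : y \in local_truncations P n ->
  exists2 g, G g & truncate g n = y.
Proof.
case: (G_subgroup) => G1 GM _.
elim: n y => [|n IHn] y /=; first by case: y; exists 1.
case: y => y f; rewrite finset.inE /= finset.inE => /andP[/IHn[g Gg gy] /ffun_onP fP].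
pose q m s : {perm X m} :=
  @dfwith _ (fun k => {perm X k}) (fun k => 1) n (oapp f 1 (insub s)) m.
have qE (t : seq_sub (level_words l n)) : q n (val t) = f t.
  by rewrite /q dfwithin valK.
pose p m s := q m s * (lab g m s)^-1.
(* [k] corrects the labels of [g] at level n and, fixing all vertices up to that level, leaves the
   labels above unchanged. *)
pose k := paut (fun m s => if s \in level_words l n then p m s else 1).
have fix_k s : is_vertex l s -> (size s <= n)%N -> wact k s = s.
  move=> sv sn; rewrite wact_paut //; apply: pact_id => i si; rewrite ifF //.
  by rewrite mem_level_words size_takel ?(ltnW si) // (ltn_eqF (leq_trans si sn)) andbF.
exists (k * g).
  apply: GM => //; apply: (@paut_level_mem n); first exact: level_words_uniq.
  move=> s sP; have := sP; rewrite mem_level_words => /andP[sv /eqP sn]; split=> //.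
  have lP m : size s = m -> lab g m s \in P m by move=> <-; apply: G_lab.
  by rewrite sn groupM ?groupV ?lP // (qE (SeqSub sP)).
congr pair.
  rewrite -gy; apply/truncate_eq => s sv sn.
  rewrite labM // lab_paut // fix_k ?(ltnW sn) // ifF ?mul1g //.
  by rewrite mem_level_words (ltn_eqF sn) andbF.
apply/ffunP => t; rewrite ffunE -qE; have tP := valP t.
have := tP; rewrite mem_level_words => /andP[tv /eqP tn].
have labE m : size (val t) = m -> lab (k * g) m (val t) = lab k m (val t) * lab g m (val t).
  by move=> <-; rewrite labM // fix_k // tn.
have labk m : size (val t) = m ->
    lab k m (val t) = if val t \in level_words l n then p m (val t) else 1.
  by move=> <-; rewrite lab_paut.
by rewrite labE // labk // tP /p mulgKV.
Qed.

Lemma index_level_stab n (K := [set g | G g /\ forall u, level u = n -> g u = u]%classic) :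
  finite_set (cosets G K) /\
  subgroup_index G K = (\prod_(i < n) #|P i| ^ (\prod_(j < i) #|X j|))%N.
Proof.
case: (G_subgroup) => G1 GM GV.
rewrite -card_local_truncations; apply: (cosets_image (f := fun g => truncate g n)).
- split=> [|g h [Gg gn] [Gh hn]|g [Gg gn]]; split=> //.
  + exact: GM.
  + by move=> u un; rewrite /= gn ?hn.
  + exact: GV.
  + by move=> u un; rewrite -{1}(gn u un) /= aut_funK.
- move=> g h Gg Gh; split=> [/truncate_eq_level gh|[_ gh]]; last exact/truncate_eq_level.
  by split=> //; apply: GM => //; apply: GV.
- by move=> g Gg; apply: truncate_local => s; apply: G_lab.
- exact: truncate_onto.
Qed.

End Singles.


Section Branch.
Variables (G : set (Aut l)) (P : forall n, {group {perm X n}}).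
Hypothesis G_subgroup : is_subgroup G.
Hypothesis G_single : forall v a, is_vertex l v -> a (size v) \in P (size v) ->
  G (spread (pred1 v) a).
Hypothesis G_lab : forall g s, G g -> is_vertex l s -> lab g (size s) s \in P (size s).
Hypothesis P_transitive : forall n (x y : X n), exists2 p, p \in P n & p x = y.
Hypothesis G_place : forall g s, G g -> is_vertex l s -> G (place s s g).

Lemma level_transitive s t : is_vertex l s -> is_vertex l t -> size s = size t ->
  exists2 g, G g & wact g s = t.
Proof.
case: (G_subgroup) => G1 GM _.
elim/last_ind: s t => [|s x IHs] t; first by case: t => // _ _ _; exists 1; rewrite ?wact_nil.
case/lastP: t => [|t y] sv tv; rewrite !size_rcons // => -[st].
have := sv; have := tv; rewrite !is_vertex_rcons => /andP[tv' yt] /andP[sv' xs].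
have [g Gg gs] := IHs t sv' tv' st.
have := wact_vertex g sv; rewrite labP // gs; set z := ext _ _.
rewrite is_vertex_rcons => /andP[_ /letterP[z' zz']]; have [y' yy'] := letterP yt.
have [p pP pz] := P_transitive z' y'.
pose a := @dfwith _ (fun k => {perm X k}) (fun k => 1) (size t) p.
exists (g * spread (pred1 t) a).
  by apply: GM => //; apply: G_single => //; rewrite /a dfwithin.
rewrite wactM labP // gs -/z zz' wact_spread; last first.
  by rewrite is_vertex_rcons tv' letter_lt.
by rewrite -cats1 pact_single ext_letter /a dfwithin pz -yy' cats1.
Qed.

(** An element that fixes level n is the product of its restrictions to the subtrees, and these stay
    in [G] by [G_place]. *)
Lemma rigid_level_stabE n :
  rigid_level_stab G n = [set g | G g /\ forall u, level u = n -> g u = u]%classic.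
Proof.
case: (G_subgroup) => G1 GM _; apply/seteqP; split=> [g [f fG ->]|g [Gg gn]].
  suff H (r : seq (vertex l)) : {in r, forall u, level u = n} ->
      G (\prod_(u <- r) f u) /\ forall u, level u = n -> (\prod_(u <- r) f u) u = u.
    by apply: H => u; rewrite mem_Omega => /eqP.
  elim: r => [|v r IHr] rn; first by rewrite big_nil.
  have [|GI In] := IHr; first by move=> u ur; apply: rn; rewrite inE ur orbT.
  have vn : level v = n by apply: rn; rewrite mem_head.
  have [Gf fv] := fG v vn; rewrite big_cons; split; first exact: GM.
  move=> u un /=; suff -> : f v u = u by exact: In.
  have far w : level w = n -> w != v -> f v w = w.
    move=> wn wv; apply: fv; apply: contra wv => /=.
    rewrite /descendant prefixE -val_eqE /= (_ : size (val v) = size (val w)) ?take_size //.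
    by rewrite -[LHS]/(level v) vn -wn.
  have [uv|] := eqVneq u v; last exact: far.
  have [//|uv'] := eqVneq (f v u) u.
  have fvn : level (f v u) = n by rewrite /level -wact_val size_wact.
  (* A factor fixes all vertices of level n but one, hence by injectivity that one too. *)
  by subst v; apply: (can_inj (aut_funK _)) (far _ fvn uv').
exists (fun u => place (val u) (val u) g); last exact: level_stab_prod.
move=> u un; split; first by apply: G_place => //; apply: valP.
move=> w uw; apply: val_inj; rewrite -wact_val wact_place_id //; exact: valP.
Qed.

Lemma placed_branch : branch G.
Proof.
split=> // [n u v un vn|n].
  have [|||g Gg gu] := @level_transitive (val u) (val v); try exact: valP.
    by rewrite -[LHS]/(level u) un -vn.
  by exists g => //; apply: val_inj; rewrite -wact_val.
rewrite rigid_level_stabE.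
by have [] := index_level_stab G_subgroup G_single G_lab n.
Qed.

End Branch.

End Levels.

(** * The group generated by rooted and directed automorphisms *)

Section DirectedGroup.
Local Open Scope group_scope.
Variables (X : nat -> finType) (P : forall n, {group {perm X n}}).
Variables (I : finType) (e : I -> forall n, {perm X n}).
Local Notation l := (fun n => #|X n|).
Local Notation dperm := (forall n, {perm X n}).
Implicit Types (g h : Aut l) (s t v w : seq nat) (a b c : dperm).

Hypothesis X_gt1 : forall n, (1 < #|X n|)%N.
Hypothesis P_gen : forall n, <<[set e i n | i : I]>> = P n.
Hypothesis P_perfect : forall n, P n \subset [~: P n, P n].
Hypothesis P_transitive : forall n (x y : X n), exists2 p, p \in P n & p x = y.
Hypothesis P_moves_fixing : forall n (x y : X n), x != y ->
  exists2 p, p \in P n & p y = y /\ p x != x.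

Definition dsingle n (p : {perm X n}) : dperm :=
  @dfwith _ (fun k => {perm X k}) (fun k => 1) n p.

Lemma dsingleE n (p : {perm X n}) : dsingle p n = p. Proof. exact: dfwithin. Qed.

Definition directed_gens : set (Aut l) :=
  ([set spread (pred1 [::]) (dsingle p) | p in [set` P 0%N]] `|`
   [set spread (spine [::]) (e i) | i in [set: I]])%classic.

Definition directed_group : set (Aut l) := smallest (@is_subgroup _) directed_gens.

Local Notation H := directed_group.

Lemma directed_group_fg : finitely_generated H.
Proof.
exists directed_gens => //; rewrite finite_setU; split; apply: finite_image => //.
Qed.

Lemma directed_group_subgroup : is_subgroup H.
Proof. exact: smallest_subgroup. Qed.

Lemma directed_group_gens g : directed_gens g -> H g.
Proof. by move=> gS K [_]; apply. Qed.

Lemma directed_group_ind (K : set (Aut l)) : is_subgroup K ->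
  (directed_gens `<=` K)%classic -> (H `<=` K)%classic.
Proof. by move=> Ksub KS g; apply. Qed.

Lemma P_e n i : e i n \in P n.
Proof. by rewrite -P_gen mem_gen // imset_f. Qed.

Lemma directed_group_lab g s : H g -> is_vertex l s -> lab g (size s) s \in P (size s).
Proof.
move=> Hg; move: s; move: g Hg.
apply: (@directed_group_ind [set g | forall s, is_vertex l s -> lab g (size s) s \in P (size s)]%classic).
  split=> [s sv|g h Hg Hh s sv|g Hg s sv].
  - by rewrite lab1.
  - by rewrite labM // groupM ?Hg // -(size_wact g s) Hh ?wact_vertex.
  - by rewrite labV // groupV -(size_wact g^-1 s) Hg ?wact_vertex.
move=> _ [[p pP <-]|[i _ <-]] s sv; rewrite lab_paut //.
  by rewrite /=; have [->|_] := eqVneq s [::]; rewrite ?dsingleE ?group1.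
by case: ifP => // _; apply: P_e.
Qed.

(** On an antichain [spread] is multiplicative, so any word in the generators [e i] can be copied.
    Only the value at the single level [n] is prescribed; the values at other levels are arbitrary,
    and [directed_commutator] later discards them. *)
Lemma spread_realize Q n (p : {perm X n}) : antichain Q ->
  (forall i, H (spread Q (e i))) -> p \in P n ->
  exists2 a, H (spread Q a) & a n = p.
Proof.
move=> Qa He; have [H1 HM HV] := directed_group_subgroup.
pose B := [set p : {perm X n} | `[< exists2 a, H (spread Q a) & a n = p >]].
have Bgr : group_set B.
  apply/group_setP; split.
    by rewrite finset.inE; apply/asboolP; exists (fun=> 1) => //; rewrite spread1.
  move=> p1 p2; rewrite !finset.inE => /asboolP[a Ha ap] /asboolP[b Hb bp].
  apply/asboolP; exists (fun n => a n * b n); last by rewrite ap bp.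
  by rewrite -spreadM //; apply: HM.
rewrite -P_gen => pP.
suff: p \in group Bgr by rewrite finset.inE => /asboolP.
apply: (fintype.subsetP _) pP; rewrite gen_subG; apply/fintype.subsetP => _ /imsetP[i _ ->].
by rewrite finset.inE; apply/asboolP; exists (e i).
Qed.

Lemma spread1_gen v (A : {set {perm X (size v)}}) :
  (forall a, a (size v) \in A -> H (spread (pred1 v) a)) ->
  forall a, a (size v) \in <<A>> -> H (spread (pred1 v) a).
Proof.
move=> HA; have [H1 HM HV] := directed_group_subgroup.
pose B := [set p : {perm X (size v)} | `[< H (spread (pred1 v) (dsingle p)) >]].
have Bgr : group_set B.
  apply/group_setP; split.
    rewrite finset.inE; apply/asboolP; rewrite (@eq_spread1 _ _ _ (fun=> 1)) ?spread1 //.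
    by rewrite dsingleE.
  move=> p1 p2; rewrite !finset.inE => /asboolP Hp1 /asboolP Hp2; apply/asboolP.
  rewrite (@eq_spread1 _ _ _ (fun n => dsingle p1 n * dsingle p2 n)) ?dsingleE //.
  by rewrite -spreadM; [exact: HM|exact: antichain1].
move=> a aA; suff: a (size v) \in group Bgr.
  rewrite finset.inE => /asboolP; by rewrite (@eq_spread1 _ _ _ a) ?dsingleE.
apply: (fintype.subsetP _) aA; rewrite gen_subG; apply/fintype.subsetP => p pA.
by rewrite finset.inE; apply/asboolP; apply: HA; rewrite dsingleE.
Qed.

(** Induction down the tree, in which the two claims support each other: single labels at [v]
    separate directed automorphisms, whose commutators give single labels one level lower. *)
Lemma directed_group_spread v : is_vertex l v ->
  (forall a, a (size v) \in P (size v) -> H (spread (pred1 v) a)) /\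
  (forall i, H (spread (spine v) (e i))).
Proof.
have [H1 HM HV] := directed_group_subgroup.
elim/last_ind: v => [_|v y IHv].
  split=> [a aP|i]; apply: directed_group_gens; [left|by right; exists i].
  exists (a 0%N) => //.
  by apply: eq_spread1; rewrite dsingleE.
rewrite is_vertex_rcons => /andP[vv /letterP[x ->]] {y}; have [Hv Hspine] := IHv vv.
have [x0 l0] := letterP (ltnW (X_gt1 (size v))).
have [x1 l1] := letterP (X_gt1 (size v)).
have x01 : x0 != x1 by apply/eqP => E; move: l1; rewrite -E -l0.
have [p pP [px1 px0]] := P_moves_fixing x01.
have sv1 : size (rcons v 1%N) = (size v).+1 by rewrite size_rcons.
(* Commutators at [v 1] come from two directed automorphisms at [v], one of them conjugated by [p];
   perfectness then yields all of [P] there. *)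
have Hcomm a : a (size (rcons v 1%N)) \in commg_set (P (size (rcons v 1%N))) (P (size (rcons v 1%N))) ->
    H (spread (pred1 (rcons v 1%N)) a).
  case/imset2P => q r qP rP aE.
  have [b Hb bq] := spread_realize (@antichain_spine v) Hspine qP.
  have [c Hc cr] := spread_realize (@antichain_spine v) Hspine rP.
  rewrite (@eq_spread1 _ _ a (fun n => [~ b n, c n])); last by rewrite aE bq cr.
  have Hp : H (spread (pred1 v) (dsingle p)) by apply: Hv; rewrite dsingleE.
  rewrite -(@directed_commutator X v x0 x1 b c (dsingle p)) ?dsingleE //.
  have Hh := HM _ _ (HM _ _ (HV _ Hp) Hc) Hp.
  exact: HM _ _ (HM _ _ (HM _ _ (HV _ Hb) (HV _ Hh)) Hb) Hh.
have H1v a : a (size (rcons v 1%N)) \in P (size (rcons v 1%N)) ->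
    H (spread (pred1 (rcons v 1%N)) a).
  by move=> aP; apply: (spread1_gen Hcomm); apply: (fintype.subsetP (P_perfect _)) aP.
(* The directed automorphism at [v] is the one at [v 0] times a label at [v 1], and this label can
   now be divided out. *)
have H0v i : H (spread (spine (rcons v 0%N)) (e i)).
  have disj s : spine (rcons v 0%N) s -> ~~ pred1 (rcons v 1%N) s.
    move=> /spineP[j ->] /=; rewrite cat_rcons -[rcons v 1%N]cats1.
    by rewrite eqseq_cat // eqxx.
  have E : spine v =1 predU (spine (rcons v 0%N)) (pred1 (rcons v 1%N)).
    by move=> s; rewrite spine_split.
  have Ea : antichain (predU (spine (rcons v 0%N)) (pred1 (rcons v 1%N))).
    by move=> s t; rewrite -!E; apply: antichain_spine.
  have := Hspine i; rewrite (eq_spread _ E) (spread_predU _ Ea disj) => Hi.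
  rewrite -[spread _ _](mulgK (spread (pred1 (rcons v 1%N)) (e i))).
  by apply: HM => //; apply: HV; apply: H1v; apply: P_e.
(* Transitivity of [P] at [v] carries the children 1 and 0 to an arbitrary child [x] by
   conjugation. *)
split=> [a aP|i].
  have [q qP qx] := P_transitive x1 x.
  rewrite -(@spread_rcons_conj X v (dsingle q) a x1 x) ?dsingleE //.
  have Hq : H (spread (pred1 v) (dsingle q)) by apply: Hv; rewrite dsingleE.
  apply: (HM) => //; apply: (HM); first exact: HV.
  by rewrite -l1; apply: H1v; move: aP; rewrite !size_rcons.
have [q qP qx] := P_transitive x0 x.
rewrite -(@spread_spine_conj X v (dsingle q) (e i) x0 x) ?dsingleE //.
have Hq : H (spread (pred1 v) (dsingle q)) by apply: Hv; rewrite dsingleE.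
by apply: (HM) => //; apply: (HM); [exact: HV|rewrite -l0].
Qed.

Lemma directed_group_single v a : is_vertex l v -> a (size v) \in P (size v) ->
  H (spread (pred1 v) a).
Proof. by move=> vv; have [Hv _] := directed_group_spread vv; apply: Hv. Qed.

Lemma directed_group_spine v i : is_vertex l v -> H (spread (spine v) (e i)).
Proof. by move=> vv; have [_] := directed_group_spread vv. Qed.

Lemma place_spread u v Q a : size u = size v -> is_vertex l u ->
  place u v (spread Q a) = spread (fun s => prefix v s && Q (u ++ drop (size v) s)) a.
Proof.
move=> uv us; apply: eq_paut => s sv.
case: ifP => //= /prefixP[w sE]; rewrite {s}sE in sv *; rewrite drop_size_cat //.
have E : size (v ++ w) = size (u ++ w) by rewrite !size_cat uv.
by rewrite E lab_paut // (is_vertex_swap uv us sv).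
Qed.

(** The sections of a directed automorphism: directed again along the ray of zeros, rooted at the
    vertices of the spine, trivial elsewhere. *)
Lemma spine_nil_cat u w : spine [::] (u ++ w) =
  if u == nseq (size u) 0%N then spine [::] w else spine [::] u && (w == [::]).
Proof.
case: eqP => [uE|uN].
  rewrite {1}uE; move: (size u) => n {uE}; apply/spineP/spineP => /= -[j E].
    exists (j - n)%N; have /(congr1 (drop n)) := E.
    rewrite drop_size_cat ?size_nseq // => ->.
    have nj : (n <= j)%N.
      rewrite leqNgt; apply/negP => jn.
      have := congr1 (fun s => nth 0%N s j) E.
      by rewrite /= nth_cat size_nseq jn nth_nseq jn nth_rcons size_nseq ltnn eqxx.
    by rewrite -[in LHS](subnKC nj) nseqD rcons_cat drop_size_cat ?size_nseq.
  by exists (n + j)%N; rewrite E nseqD rcons_cat.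
apply/spineP/andP => /= [[j E]|[/spineP[j ->] /eqP->]]; last by exists j; rewrite cats0.
case/lastP: w E => [|w y]; rewrite ?cats0 => E; first by split=> //; apply/spineP; exists j.
case: uN; move: E; rewrite -rcons_cat => /rcons_inj[E _].
have /(congr1 (take (size u))) := E; rewrite take_size_cat // => ->.
have uj : (size u <= j)%N by rewrite -[j](size_nseq j 0%N) -E size_cat leq_addr.
by rewrite -(subnKC uj) nseqD take_size_cat ?size_nseq.
Qed.

(** Induction over products of generators, with [u] and [v] arbitrary because [place_mul] changes
    [u]. The sections of the generators are directed, rooted or trivial. *)
Lemma directed_group_place g u v : H g -> is_vertex l u -> is_vertex l v ->
  size u = size v -> H (place u v g).
Proof.
have [H1 HM HV] := directed_group_subgroup.
move=> Hg; move: u v; move: g Hg.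
apply: (@directed_group_ind [set g | forall u v, is_vertex l u -> is_vertex l v ->
  size u = size v -> H (place u v g)]%classic).
  split=> [u v us vs uv|g h Hg Hh u v us vs uv|g Hg u v us vs uv].
  - by rewrite place1.
  - rewrite place_mul //; apply: HM; first exact: Hg.
    by apply: Hh; rewrite ?wact_vertex ?size_wact.
  - by rewrite placeV //; apply: HV; apply: Hg; rewrite ?wact_vertex ?size_wact.
move=> _ [[p pP <-]|[i _ <-]] u v us vs uv; rewrite place_spread //.
  case: u v uv us vs => [|x u] [|y v] // uv us vs.
    rewrite (eq_spread _ (_ : _ =1 pred1 [::])).
      by apply: directed_group_single; rewrite ?dsingleE.
    by move=> s; rewrite prefix0s /= drop0.
  rewrite (eq_spread _ (_ : _ =1 pred0)); last by move=> s /=; rewrite andbF.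
  by rewrite (_ : spread _ _ = 1) // -paut1; apply: eq_paut.
have [u0|u0] := boolP (u == nseq (size u) 0%N).
  rewrite (eq_spread _ (_ : _ =1 spine v)); first exact: directed_group_spine.
  move=> s; rewrite spine_nil_cat u0; apply/andP/spineP => [[/prefixP[w ->]]|[j ->]].
    by rewrite drop_size_cat // => /spineP[j ->]; exists j.
  by rewrite prefix_prefix drop_size_cat //; split=> //; apply/spineP; exists j.
have [uS|uS] := boolP (spine [::] u).
  rewrite (eq_spread _ (_ : _ =1 pred1 v)).
    by apply: directed_group_single => //; apply: P_e.
  move=> s; rewrite spine_nil_cat (negbTE u0) uS /=; apply/andP/eqP => [[/prefixP[w ->]]|->].
    by rewrite drop_size_cat // => /eqP->; rewrite cats0.
  by rewrite prefix_refl drop_size.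
rewrite (eq_spread _ (_ : _ =1 pred0)).
  by rewrite (_ : spread _ _ = 1) // -paut1; apply: eq_paut.
by move=> s; rewrite spine_nil_cat (negbTE u0) (negbTE uS) andbF.
Qed.

Lemma directed_group_branch : branch H.
Proof.
apply: (@placed_branch _ _ _ P) => //.
- by move=> n; apply: ltnW.
- exact: directed_group_subgroup.
- exact: directed_group_single.
- exact: directed_group_lab.
- by move=> g s Hg sv; apply: directed_group_place.
Qed.

End DirectedGroup.

(** * Asymptotics of the level quotients *)

Import Order.TTheory GRing.Theory Num.Theory.
Import numFieldNormedType.Exports.

Section Estimates.
Local Open Scope ring_scope.
Local Open Scope classical_set_scope.
Variable R : realType.
Implicit Types (x y e : R) (n k c : nat).

(** Weighted Cesaro means: the denominators grow at least linearly, so finitely many early terms do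
    not influence the limit. *)
Lemma weighted_mean_cvg (w : nat -> nat) (a b : nat -> R) (alpha beta : R) :
  0 < beta -> (forall n, (0 < w n)%N) -> (forall n, beta <= b n) ->
  (forall e, 0 < e -> exists M, forall n, (M <= n)%N -> `|a n - alpha * b n| <= e * b n) ->
  (\sum_(i < n) (w i)%:R * a i) / (\sum_(i < n) (w i)%:R * b i) @[n --> \oo] --> alpha.
Proof.
move=> beta0 w0 bb ab.
pose A n := \sum_(i < n) (w i)%:R * a i; pose B n := \sum_(i < n) (w i)%:R * b i.
have w1 n : 1 <= (w n)%:R :> R by rewrite ler1n.
have Bge n : n%:R * beta <= B n.
  elim: n => [|n IHn]; first by rewrite mul0r /B big_ord0.
  rewrite /B big_ord_recr /= -/(B n); have := w1 n; have := bb n.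
  rewrite -natr1; nra.
apply/cvgrPdist_le => e e0.
have [M MP] := ab (e / 2) (divr_gt0 e0 (ltr0Sn _ _)).
pose D := `|A M - alpha * B M|.
(* Beyond [M] each term adds a relative error of at most e/2; the constant [D] is later absorbed by
   the other half of e. *)
have bound n : (M <= n)%N -> `|A n - alpha * B n| <= D + e / 2 * (B n - B M).
  move=> /subnKC <-; elim: (n - M)%N => [|d IHd].
    by rewrite addn0 subrr mulr0 addr0.
  rewrite addnS; have Mn : (M <= M + d)%N by rewrite leq_addr.
  have /= h := MP _ Mn; rewrite /A /B !big_ord_recr /= -/(A _) -/(B _).
  set m := (M + d)%N in IHd h *.
  have -> : A m + (w m)%:R * a m - alpha * (B m + (w m)%:R * b m) =
     (A m - alpha * B m) + (w m)%:R * (a m - alpha * b m) by ring.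
  apply: le_trans (ler_normD _ _) _; rewrite normrM (ger0_norm (ler0n _ _)).
  have : (w m)%:R * `|a m - alpha * b m| <= (w m)%:R * (e / 2 * b m) by apply: ler_wpM2l.
  have -> : D + e / 2 * (B m + (w m)%:R * b m - B M) =
    D + e / 2 * (B m - B M) + (w m)%:R * (e / 2 * b m) by ring.
  lra.
near=> n.
have n_pos : (0 < n)%N by near: n; exists 1%N.
have Mn : (M <= n)%N by near: n; exists M.
have B0 : 0 < B n by apply: lt_le_trans (Bge n); rewrite mulr_gt0 ?ltr0n.
have BM0 : 0 <= B M by apply: le_trans (Bge M); rewrite mulr_ge0 ?ler0n ?ltW.
have Dn : D <= e / 2 * B n.
  have nD : 2 * D / (e * beta) <= n%:R.
    apply: (@le_trans _ _ (Num.truncn (2 * D / (e * beta))).+1%:R).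
      by apply/ltW; rewrite truncnS_gt.
    by rewrite ler_nat; near: n; exists (Num.truncn (2 * D / (e * beta))).+1.
  move: nD; rewrite ler_pdivrMr ?mulr_gt0 // => nD.
  have := Bge n; nra.
rewrite -/(A n) -/(B n).
have -> : alpha - A n / B n = - ((A n - alpha * B n) / B n).
  by field; apply: lt0r_neq0.
rewrite normrN normrM normfV (gtr0_norm B0) ler_pdivrMr //.
have := bound n Mn; nra.
Unshelve. all: by end_near.
Qed.

Lemma ln_nat_ge0 n : 0 <= ln n%:R :> R.
Proof.
case: n => [|n]; first by rewrite ln0.
by rewrite ln_ge0 // ler1n.
Qed.

Lemma ln_fact_ge n : n%:R * ln n%:R - n%:R <= ln (n`!)%:R :> R.
Proof.
elim: n => [|n IHn]; first by rewrite mul0r subr0 fact0 ln1.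
rewrite factS natrM lnM ?posrE ?ltr0n ?fact_gt0 //.
case: n IHn => [|n] IHn; first by rewrite fact0 ln1; lra.
set m := n.+1 in IHn *.
have m0 : 0 < m%:R :> R by rewrite ltr0n.
have step : ln m.+1%:R - ln m%:R <= m%:R^-1 :> R.
  rewrite -ln_div ?posrE ?ltr0n //.
  have -> : m.+1%:R / m%:R = 1 + m%:R^-1 :> R by rewrite -natr1 mulrDl divff ?lt0r_neq0 // mul1r.
  by apply: le_ln1Dx; apply: (@lt_trans _ _ 0); rewrite ?ltrN10 // invr_gt0.
have : m%:R * (ln m.+1%:R - ln m%:R) <= 1 :> R.
  by rewrite -[leRHS](divff (lt0r_neq0 m0)) ler_pM2l.
rewrite -(@natr1 R m); lra.
Qed.

Lemma ln_fact_le n : ln (n`!)%:R <= n%:R * ln n%:R :> R.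
Proof.
elim: n => [|n IHn]; first by rewrite mul0r fact0 ln1.
rewrite factS natrM lnM ?posrE ?ltr0n ?fact_gt0 //.
have : n%:R * ln n%:R <= n%:R * ln n.+1%:R :> R.
  apply: ler_wpM2l => //; case: n {IHn} => [|n]; first by rewrite ln0 // ln1.
  by rewrite ler_ln ?posrE ?ltr0n // ler_nat.
rewrite -(@natr1 R n) mulrDl mul1r; lra.
Qed.

(** Here [x] = log k, [y] = log c, [a] = log |P|, [b] = log (kc)!. The leading error (1 - alpha) y -
    alpha x lies between -6 and delta x. A positive delta keeps [e] meaningful for alpha = 0, and
    delta c >= 1 absorbs the term k x into k c delta x. *)
Lemma log_size_bound (alpha delta k c a b x y : R) :
  0 <= alpha <= 1 -> 0 < delta -> 0 <= k -> 0 <= x -> 0 <= y -> 1 <= c -> 1 <= delta * c ->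
  let e := (1 - alpha) / (alpha + delta) in
  e * y <= x <= e * y + 6 ->
  k * (c * y - c - 1) <= a <= k * x + k * c * y ->
  k * c * (x + y) - k * c <= b <= k * c * (x + y) ->
  `|a - alpha * b| <= k * c * (2 * delta * (x + y) + 8).
Proof.
move=> /andP[al0 al1] d0 k0 x0 y0 c1 dc e /andP[xl xu] /andP[le_a ge_a] /andP[le_b ge_b].
have ey : e * y * (alpha + delta) = (1 - alpha) * y.
  rewrite /e; field; lra.
have e0 : 0 <= e by apply: divr_ge0; lra.
move: e xl xu ey e0 => e xl xu ey e0.
have kc : 0 <= k * c by rewrite mulr_ge0 //; lra.
have kkc : k <= k * c by rewrite ler_peMr.
have kdc : k * x <= k * c * (delta * x).
  rewrite (_ : k * c * (delta * x) = (k * x) * (delta * c)); last by ring.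
  by rewrite ler_peMr // mulr_ge0.
have ab1 : alpha * (k * c * (x + y) - k * c) <= alpha * b by apply: ler_wpM2l.
have ab2 : alpha * b <= alpha * (k * c * (x + y)) by apply: ler_wpM2l.
have u1 : (1 - alpha) * y - alpha * x <= delta * x.
  have : e * y * (alpha + delta) <= x * (alpha + delta) by apply: ler_wpM2r => //; lra.
  lra.
have u2 : -6 <= (1 - alpha) * y - alpha * x.
  rewrite -ey.
  have : alpha * (x - e * y) <= alpha * 6 by apply: ler_wpM2l => //; lra.
  have : 0 <= e * y * delta.
    by rewrite !mulr_ge0 // ltW.
  lra.
have v1 := ler_wpM2l kc u1; have v2 := ler_wpM2l kc u2.
have dy : 0 <= k * c * (delta * y) by rewrite !mulr_ge0 //; lra.
have akc : alpha * (k * c) <= k * c by rewrite ler_piMl.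
have E : k * c * ((1 - alpha) * y - alpha * x) =
  k * c * y - alpha * (k * c * (x + y)) by ring.
rewrite E in v1 v2.
rewrite ler_norml; apply/andP; split.
  have : 0 <= k * c * (delta * x) by rewrite !mulr_ge0 //; lra.
  lra.
lra.
Qed.

(* Both sizes are odd, since [alt_gen] generates the alternating group only in *)
(* odd degree.                                                                 *)
Definition bottom_size n := (2 * n).+2.+3.

(** The summand 1/(n+1) keeps the exponent finite when alpha = 0 and vanishes in the limit. *)
Definition top_size (alpha : R) n :=
  (2 * Num.truncn ((bottom_size n)%:R `^ ((1 - alpha) / (alpha + n.+1%:R^-1)))).+2.+3.

Lemma ln_le_sub1 x : 0 < x -> ln x <= x - 1.
Proof.
move=> x0; have E : x = 1 + (x - 1) by ring.
by rewrite {1}E; apply: le_ln1Dx; lra.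
Qed.

Lemma log_size_ratio (alpha : R) (a : nat -> R) : 0 <= alpha <= 1 ->
  let k := top_size alpha in let c := bottom_size in
  (forall n, (k n)%:R * (ln ((c n)`!)%:R - ln 2) <= a n) ->
  (forall n, a n <= (k n)%:R * ln (k n)%:R + (k n)%:R * (c n)%:R * ln (c n)%:R) ->
  forall e, 0 < e -> exists M, forall n, (M <= n)%N ->
    `|a n - alpha * ln ((k n * c n)`!)%:R| <= e * ln ((k n * c n)`!)%:R.
Proof.
move=> al k c a_ge a_le eps eps0.
(* These thresholds give delta <= eps/8 and y >= 16/eps + 4, whence 2 delta (x + y) + 8 <= eps (x +
   y - 1). *)
exists (maxn (Num.truncn (8 / eps)).+1 (Num.truncn (expR (16 / eps + 4))).+1) => n.
rewrite geq_max => /andP[M1 M2].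
have d_le : n.+1%:R^-1 <= eps / 8.
  rewrite -[eps / 8]invrK lef_pV2 ?posrE ?invr_gt0 ?divr_gt0 ?ltr0n // invf_div.
  apply: (@le_trans _ _ (Num.truncn (8 / eps)).+1%:R); first by apply/ltW; rewrite truncnS_gt.
  by rewrite ler_nat (leq_trans M1).
have y_ge : 16 / eps + 4 <= ln (c n)%:R.
  rewrite -[leLHS]expRK ler_ln ?posrE ?expR_gt0 ?ltr0n //.
  apply: (@le_trans _ _ (Num.truncn (expR (16 / eps + 4))).+1%:R).
    by apply/ltW; rewrite truncnS_gt.
  by rewrite ler_nat (leq_trans M2) // /c /bottom_size; lia.
have k0 : 0 < (k n)%:R :> R by rewrite ltr0n.
have c0 : 0 < (c n)%:R :> R by rewrite ltr0n.
have c1 : 1 <= (c n)%:R :> R by rewrite ler1n.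
have x0 := ln_nat_ge0 (k n); have y0 := ln_nat_ge0 (c n).
have dc : 1 <= n.+1%:R^-1 * (c n)%:R :> R.
  by rewrite ler_pdivlMl ?ltr0n // mulr1 ler_nat /c /bottom_size; lia.
set x := ln (k n)%:R in x0 *; set y := ln (c n)%:R in y0 y_ge *.
pose e := (1 - alpha) / (alpha + n.+1%:R^-1).
have e0 : 0 <= e.
  case/andP: al => al0 al1; apply: divr_ge0; first lra.
  by rewrite addr_ge0 // invr_ge0 ler0n.
have lnxy : ln ((c n)%:R `^ e) = e * y by rewrite ln_powR.
have ce1 : 1 <= (c n)%:R `^ e by rewrite -[leLHS](powRr0 (c n)%:R) ler_powR.
have /andP[t1 t2] := truncn_itv (le_trans ler01 ce1).
have kE : (k n)%:R = 2 * (Num.truncn ((c n)%:R `^ e))%:R + 5 :> R.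
  have five t : (2 * t).+2.+3%:R = 2 * t%:R + 5 :> R.
    by rewrite -[(2 * t).+2.+3]/(5 + 2 * t)%N natrD natrM addrC.
  exact: five.
(* [k n] lies between c^e and 7 c^e, and ln 7 <= 6. *)
have xe : e * y <= x <= e * y + 6.
  rewrite -lnxy; apply/andP; split.
    rewrite ler_ln ?posrE //; last by lra.
    by rewrite kE; move: t2; rewrite -natr1; lra.
  have : x <= ln (7 * (c n)%:R `^ e).
    rewrite ler_ln ?posrE //; last by lra.
    by rewrite kE; lra.
  rewrite lnM ?posrE; [|lra..].
  have := @ln_le_sub1 7; lra.
have N_ge : (k n)%:R * (c n)%:R * (x + y) - (k n)%:R * (c n)%:R <= ln ((k n * c n)`!)%:R.
  have := ln_fact_ge (k n * c n); rewrite natrM lnM ?posrE //.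
have N_le : ln ((k n * c n)`!)%:R <= (k n)%:R * (c n)%:R * (x + y).
  by have := ln_fact_le (k n * c n); rewrite natrM lnM ?posrE.
have d0 : 0 < n.+1%:R^-1 :> R by rewrite invr_gt0 ltr0n.
have := @log_size_bound alpha n.+1%:R^-1 (k n)%:R (c n)%:R (a n) _ x y al d0 (ltW k0) x0 y0 c1 dc xe.
move=> /(_ (ln ((k n * c n)`!)%:R)).
rewrite N_ge N_le => H.
have /H {}H : (k n)%:R * ((c n)%:R * y - (c n)%:R - 1) <= a n
    <= (k n)%:R * x + (k n)%:R * (c n)%:R * y.
  rewrite a_le andbT; apply: le_trans (a_ge n); apply: ler_wpM2l; first exact: ltW.
  have := ln_fact_ge (c n); have := @ln_le_sub1 2; rewrite -/y; lra.
apply: le_trans (H isT) _.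
apply: (@le_trans _ _ (eps * ((k n)%:R * (c n)%:R * (x + y) - (k n)%:R * (c n)%:R))); last first.
  by apply: ler_wpM2l => //; exact: ltW.
have -> : eps * ((k n)%:R * (c n)%:R * (x + y) - (k n)%:R * (c n)%:R) =
  (k n)%:R * (c n)%:R * (eps * (x + y - 1)) by ring.
apply: ler_wpM2l; first by rewrite mulr_ge0 // ltW.
have xy0 : 0 <= x + y by rewrite addr_ge0.
have h1 : n.+1%:R^-1 * (x + y) <= eps / 8 * (x + y) by apply: ler_wpM2r.
have h2 : eps * (16 / eps + 4) <= eps * y by apply: ler_wpM2l => //; exact: ltW.
rewrite (_ : eps * (16 / eps + 4) = 16 + 4 * eps) in h2; last by field; lra.
have h4 : 0 <= eps * x by rewrite mulr_ge0 // ltW.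
move: (n.+1%:R^-1) h1 => d h1; clear -h1 h2 h4 eps0.
move: x y h1 h2 h4 => {}x {}y h1 h2 h4; lra.
Qed.

End Estimates.

(** * The ambient group of all automorphisms *)

Section FullGroup.
Local Open Scope group_scope.
Variable X : nat -> finType.
Local Notation l := (fun n => #|X n|).
Hypothesis X0 : forall n, (0 < #|X n|)%N.

Lemma setT_branch : branch (setT : set (Aut l)).
Proof.
apply: (@placed_branch _ _ _ (fun n => [set: {perm X n}]%G)) => //.
- by move=> *; rewrite finset.inE.
- by move=> n x y; exists (tperm x y); rewrite ?finset.inE ?tpermL.
Qed.

Lemma index_setT n :
  subgroup_index setT (level_stab (setT : set (Aut l)) n) =
  (\prod_(i < n) (#|X i|)`! ^ (\prod_(j < i) #|X j|))%N.
Proof.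
have [//|//|*|_ ->] := @index_level_stab X X0 setT (fun n => [set: {perm X n}]%G) _ _ _ n.
  by rewrite finset.inE.
by apply: eq_bigr => i _; rewrite [in LHS]card_Sym.
Qed.

End FullGroup.

Section LogIndex.
Local Open Scope ring_scope.

Lemma ln_prod_expn (R : realType) (p w : nat -> nat) n : (forall i, (0 < p i)%N) ->
  ln (\prod_(i < n) p i ^ w i)%N%:R = \sum_(i < n) (w i)%:R * ln (p i)%:R :> R.
Proof.
move=> p0; elim: n => [|n IHn]; first by rewrite !big_ord0 ln1.
rewrite !big_ord_recr /= natrM lnM ?posrE ?ltr0n ?expn_gt0 ?p0 //; last first.
  by apply: prodn_gt0 => i; rewrite expn_gt0 p0.
by rewrite IHn natrX lnXn ?ltr0n // mulr_natl.
Qed.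

End LogIndex.

(** * The groups attached to alpha *)

Section Construction.
Variables (R : realType) (alpha : R).
Local Notation k := (top_size alpha).
Local Notation c := bottom_size.

Definition block_letters n : finType := ('I_(k n) * 'I_(c n))%type.
Local Notation X := block_letters.

Lemma card_block_letters n : #|X n| = (k n * c n)%N.
Proof. by rewrite card_prod !card_ord. Qed.

Definition block_group n : {group {perm X n}} := alt_wreath _ ord0.

Definition block_gen (p : bool * bool) n : {perm X n} :=
  if p.1 then top_perm _ (alt_gen _ p.2) else bot_perm ord0 (alt_gen _ p.2).

Lemma block_group_gen n : (<<[set block_gen p n | p : bool * bool]>> = block_group n)%g.
Proof.
apply: alt_wreath_gen; apply: Alt_gen; rewrite /= ?negbK oddM //.
Qed.

Local Notation H := (directed_group block_group block_gen).
Local Notation G := (setT : set (Aut (fun n => #|X n|))).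

Lemma block_letters_gt1 n : (1 < #|X n|)%N.
Proof. by rewrite card_block_letters. Qed.

Lemma card_top_gt4 n : (4 < #|'I_(k n)|)%N. Proof. by rewrite card_ord. Qed.
Lemma card_bottom_gt4 n : (4 < #|'I_(c n)|)%N. Proof. by rewrite card_ord. Qed.

Let perfect n := alt_wreath_perfect (card_top_gt4 n) (card_bottom_gt4 n) ord0.
Let transitive n := @alt_wreath_transitive _ _ (card_top_gt4 n) (card_bottom_gt4 n) ord0.
Let moves n := @alt_wreath_moves_fixing _ _ (card_top_gt4 n) (card_bottom_gt4 n) ord0.

Lemma block_branch : branch H.
Proof.
exact: (directed_group_branch block_letters_gt1 block_group_gen perfect transitive moves).
Qed.

Lemma block_index n : subgroup_index H (H `&` level_stab G n)%classic =
  (\prod_(i < n) #|block_group i| ^ (\prod_(j < i) #|X j|))%N.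
Proof.
have [||||_ <-] := @index_level_stab X _ H block_group _ _ _ n.
- by move=> i; apply: ltnW; apply: block_letters_gt1.
- exact: directed_group_subgroup.
- exact: (directed_group_single block_letters_gt1 block_group_gen perfect transitive moves).
- exact: (directed_group_lab block_group_gen).
congr subgroup_index; apply/seteqP; split=> g [].
  by move=> Hg [_ gn].
by move=> Hg gn; split.
Qed.

Local Open Scope ring_scope.

Lemma ln_block_group_ge n :
  (k n)%:R * (ln ((c n)`!)%:R - ln 2) <= ln #|block_group n|%:R :> R.
Proof.
have A2 : (2 * #|('Alt_('I_(c n)))%g|)%N = (c n)`! by rewrite card_Alt ?card_ord.
have A0 : (0 < #|('Alt_('I_(c n)))%g|)%N by rewrite -(ltn_pmul2l (isT : 0 < 2)%N) muln0 A2 fact_gt0.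
rewrite -A2 natrM lnM ?posrE ?ltr0n // addrC addKr.
rewrite mulr_natl -lnXn ?ltr0n // ler_ln ?posrE ?exprn_gt0 ?ltr0n ?cardG_gt0 //.
rewrite -natrX ler_nat -[X in (_ ^ X)%N](card_ord (k n)).
exact: card_alt_wreath_ge (card_top_gt4 n) _.
Qed.

Lemma ln_block_group_le n : ln #|block_group n|%:R <=
  (k n)%:R * ln (k n)%:R + (k n)%:R * (c n)%:R * ln (c n)%:R :> R.
Proof.
rewrite -natrM !mulr_natl -!lnXn ?ltr0n // -lnM ?posrE ?exprn_gt0 ?ltr0n //.
have := @card_alt_wreath_le 'I_(k n) 'I_(c n) ord0 ord0; rewrite !card_ord => W_le.
rewrite -!natrX -natrM ler_ln ?posrE ?ltr0n ?cardG_gt0 ?ler_nat //.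
exact: leq_trans (cardG_gt0 _) W_le.
Qed.

(** The quotients of logarithms converge, so the lower limit is the limit. Since (kc)! >= 2, the
    terms of the denominator are bounded below by ln 2. *)
Lemma block_dim : 0 <= alpha <= 1 -> hausdorff_dim R G H = alpha%:E.
Proof.
move=> al; rewrite /hausdorff_dim.
pose w i := (\prod_(j < i) #|X j|)%N.
have X0 i : (0 < #|X i|)%N by apply: ltnW; apply: block_letters_gt1.
have w0 i : (0 < w i)%N by apply: prodn_gt0.
have E n : ln (subgroup_index H (H `&` level_stab G n)%classic)%:R /
    ln (subgroup_index G (level_stab G n))%:R =
    (\sum_(i < n) (w i)%:R * ln #|block_group i|%:R) /
    (\sum_(i < n) (w i)%:R * ln ((k i * c i)`!)%:R) :> R.
  rewrite block_index index_setT //.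
  rewrite (@ln_prod_expn R (fun i => #|block_group i|) w) => [|i]; last exact: cardG_gt0.
  rewrite (@ln_prod_expn R (fun i => (#|X i|)`!) w) => [|i]; last exact: fact_gt0.
  by congr (_ / _); apply: eq_bigr => i _; rewrite card_block_letters.
have cvgE : ((\sum_(i < n) (w i)%:R * ln #|block_group i|%:R) /
    (\sum_(i < n) (w i)%:R * ln ((k i * c i)`!)%:R) @[n --> \oo] --> alpha)%classic.
  apply: (@weighted_mean_cvg R w (fun i => ln #|block_group i|%:R)
    (fun i => ln ((k i * c i)`!)%:R) alpha (ln 2)) => //.
  - by rewrite ln_gt0 // ltr1n.
  - move=> n; rewrite ler_ln ?posrE ?ltr0n ?fact_gt0 // ler_nat.
    by rewrite (leq_trans _ (leq_fact (_ : 2 <= _)%N)) // -card_block_letters block_letters_gt1.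
  - exact: log_size_ratio al ln_block_group_ge ln_block_group_le.
apply: (cvg_limn_einf_sup _).1; apply/fine_cvgP; split; first by near=> n.
by apply: cvg_trans cvgE; apply: near_eq_cvg; near=> n; rewrite /= E.
Unshelve. all: by end_near.
Qed.

End Construction.

Local Open Scope classical_set_scope.
Local Open Scope ring_scope.

Theorem theorem5p3 (R : realType) (alpha : R) (alpha01 : 0 <= alpha <= 1) :
  exists (l : nat -> nat) (G H : set (Aut l)),
    [/\ forall n, (2 <= l n)%N,
        branch G,
        is_subgroup H /\ H `<=` G,
        hausdorff_dim R G H = alpha%:E &
        finitely_generated H /\ acts_as_branch_group H].
Proof.
exists (fun n => #|block_letters alpha n|), setT.
exists (directed_group (@block_group R alpha) (@block_gen R alpha)).
have gt1 := @block_letters_gt1 R alpha; split=> //.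
- by apply: setT_branch => n; apply: ltnW.
- by split=> //; apply: directed_group_subgroup.
- exact: block_dim.
- split; first exact: directed_group_fg.
  exists (fun n => #|block_letters alpha n|), id; split=> //.
  by rewrite image_id; apply: block_branch.
Qed.
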